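(* Let $V=V_{L_2}$ be the lattice vertex operator algebra over $\mathbb{C}$ of the $A_1$ root lattice $L_2=\mathbb{Z}\alpha$, $(\alpha,\alpha)=2$, with Virasoro vector $\omega$, and let $G$ be a subgroup of $\mathrm{Aut}(V)\cong PSL(2,\mathbb{C})$ isomorphic to $Alt_4$, $Sym_4$ or $Alt_5$. Let $v^1,v^2,v^3\in V^G$ be the Virasoro highest weight vectors corresponding, under the identification $\varphi$ described in the context, to the basic homogeneous polynomial invariants of the preimage of $G$ in $SL(2,\mathbb{C})$, namely $$(v^1,v^2,v^3)=\begin{cases}(\varphi^{-1}(f_6),\varphi^{-1}(f_8),\varphi^{-1}(f_{12})) & \text{if } G\cong Alt_4,\\ (\varphi^{-1}(g_8),\varphi^{-1}(g_{12}),\varphi^{-1}(g_{18})) & \text{if } G\cong Sym_4,\\ (\varphi^{-1}(h_{12}),\varphi^{-1}(h_{20}),\varphi^{-1}(h_{30})) & \text{if } G\cong Alt_5.\end{cases}$$ Then the vertex operator algebra $V^G$ is generated by $\{\omega,v^1,v^2,v^3\}$.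
   Context: $V^G$ is the fixed point vertex operator subalgebra of $V$ under $G$. A subset $X$ of a vertex operator algebra $U$ generates $U$ if the smallest subspace of $U$ containing $X$ and the vacuum and closed under all products $u_nv$ ($n\in\mathbb{Z}$, where $Y(u,z)=\sum_{n\in\mathbb{Z}}u_nz^{-n-1}$) is $U$. The group $SL(2,\mathbb{C})$ acts on $V$ through $PSL(2,\mathbb{C})\cong\mathrm{Aut}(V)$, and acts on $\mathbb{C}[x,y]$ by algebra automorphisms so that $\mathbb{C}x+\mathbb{C}y$ is the natural module. $W_m$ denotes the irreducible $SL(2,\mathbb{C})$-module of dimension $m$, so that the homogeneous polynomials of degree $m$ form a copy of $W_{m+1}$. As a module for $SL(2,\mathbb{C})$ and the Virasoro algebra, $V\cong\bigoplus_{m\ge 0}W_{2m+1}\otimes L(1,m^2)$, where $L(c,h)$ is the irreducible highest weight Virasoro module of central charge $c$ and highest weight $h$. Let $H\subset V$ be the span of the highest weight vectors for the Virasoro algebra (vectors annihilated by $L(n)$ for all $n\ge 1$). Then $H=\bigoplus_{m\geq 0} H_{m^2}$, where $H_{m^2}$, its subspace of conformal weight $m^2$, is isomorphic to $W_{2m+1}$. Let $\mathbb{C}[x,y]^+$ be the span of the homogeneous polynomials of even degree. Fix an isomorphism of $SL(2,\mathbb{C})$-modules $\varphi:H\to\mathbb{C}[x,y]^+$ mapping $H_{m^2}$ onto the homogeneous polynomials of degree $2m$, for every $m\ge 0$. Let $\tilde G$ be the preimage of $G$ in $SL(2,\mathbb{C})$ and $A=\mathbb{C}[x,y]^{\tilde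 G}$. Fix homogeneous generators of $A$ (the subscript is the degree) as follows, which are known to exist: if $G\cong Alt_4$ (so $\tilde G\cong SL(2,3)$), $A=\mathbb{C}[f_6,f_8,f_{12}]$ subject to the relation $f_6^4+f_8^3+f_{12}^2=0$; if $G\cong Sym_4$ (so $\tilde G\cong 2\cdot Sym_4$), $A=\mathbb{C}[g_8,g_{12},g_{18}]$ subject to the relation $g_{18}^2+g_8^3g_{12}+g_{12}^3=0$; if $G\cong Alt_5$ (so $\tilde G\cong SL(2,5)$), $A=\mathbb{C}[h_{12},h_{20},h_{30}]$ subject to the relation $h_{12}^5+h_{20}^3+h_{30}^2=0$. *)

(* Defs.v *)
From HB Require Import structures.
From mathcomp Require Import all_boot all_order all_algebra all_fingroup alt.
From mathcomp Require Import finmap multiset.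
From mathcomp Require Import complex.
From mathcomp Require Import mathcomp_extra boolp classical_sets functions.
From mathcomp Require Import cardinality fsbigop reals.
From mathcomp Require Import freeg mpoly.

Set Implicit Arguments.
Unset Strict Implicit.
Unset Printing Implicit Defensive.

Import Order.TTheory GRing.Theory Num.Theory.

Local Open Scope classical_set_scope.
Local Open Scope ring_scope.

(** The sums [\sum_(i \in A) F i] below are the sums with finite support of
    [fsbigop]: every one of them has only finitely many nonzero terms, by the
    truncation property or by its Fock space analogue. *)

(** * Vertex operator algebras *)

(** [vprod u n v] is the product u_n v, where Y(u,z) = sum_n u_n z^(-n-1). *)
Record vertex_data (C : numFieldType) := VertexData {
  vsort :> lmodType C;
  vprod : vsort -> int -> vsort -> vsort;
  vac   : vsort;
  vconf : vsort }.

Arguments vprod {C v}.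
Arguments vac {C v}.
Arguments vconf {C v}.

Definition binz (C : numFieldType) (m : int) (i : nat) : C :=
  (\prod_(j < i) (m - j%:Z)%:~R) / i`!%:R.

Section VertexAlgebra.
Variables (C : numFieldType) (V : vertex_data C).
Implicit Types (u v w : V) (l m n : int).

Definition Lop n v : V := vprod vconf (n + 1) v.

Definition weight_vector n v : Prop := Lop 0 v = n%:~R *: v.

Definition borcherds_identity : Prop := forall u v w l m n,
  \sum_(i \in [set: nat])
     binz C m i *: vprod (vprod u (l + i%:Z) v) (m + n - i%:Z) w =
  \sum_(i \in [set: nat])
     ((-1) ^+ i * binz C l i) *:
       (vprod u (l + m - i%:Z) (vprod v (n + i%:Z) w)
        - (-1) ^ l *: vprod v (l + n - i%:Z) (vprod u (m + i%:Z) w)).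

Record is_vertex_algebra : Prop := {
  vprod_linearl : forall n v, linear (fun u => vprod u n v : V);
  vprod_linearr : forall n u, linear (fun v => vprod u n v : V);
  vprod_trunc   : forall u v, exists N : int, forall n, N <= n -> vprod u n v = 0;
  vprod_vacl    : forall n v, vprod vac n v = if n == -1 then v else 0;
  vprod_vacr    : forall u, vprod u (-1) vac = u;
  vprod_vacr0   : forall n u, 0 <= n -> vprod u n vac = 0;
  vprod_borcherds : borcherds_identity }.

Record is_conformal : Prop := {
  conf_virasoro : exists c : C, forall m n v,
    Lop m (Lop n v) - Lop n (Lop m v) =
      (m - n)%:~R *: Lop (m + n) v
      + (if m + n == 0 then ((m ^+ 3 - m)%:~R / 12%:R * c) *: v else 0);
  conf_deriv : forall u n v,
    vprod (Lop (-1) u) n v = - n%:~R *: vprod u (n - 1) v;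
  conf_graded : forall v, exists s : seq V, v = \sum_(w <- s) w /\
    forall w, w \in s -> exists n, weight_vector n w;
  conf_finite : forall n, exists s : seq V, forall v, weight_vector n v ->
    exists c : nat -> C, v = \sum_(i < size s) c i *: s`_i;
  conf_bounded : exists N : int, forall n v,
    n < N -> weight_vector n v -> v = 0 }.

End VertexAlgebra.

Record voa (C : numFieldType) := Voa {
  voa_data :> vertex_data C;
  voa_vertex : is_vertex_algebra voa_data;
  voa_conformal : is_conformal voa_data }.

Section Notions.
Variable C : numFieldType.

Definition vertex_hom (V W : vertex_data C) (f : V -> W) : Prop :=
  [/\ linear f, f vac = vac, f vconf = vconf &
      forall u n v, f (vprod u n v) = vprod (f u) n (f v)].

Definition vertex_isomorphic (V W : vertex_data C) : Prop :=
  exists f : V -> W, vertex_hom f /\ bijective f.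

Variable V : vertex_data C.

Definition Aut : set (V -> V) := [set g | vertex_hom g /\ bijective g].

Definition Aut_subgroup (G : set (V -> V)) : Prop :=
  [/\ G `<=` Aut, G id, forall g h, G g -> G h -> G (g \o h) &
      forall g h, G g -> cancel g h -> cancel h g -> G h].

Definition isomorphic_to (gT : finGroupType) (K : {group gT})
    (G : set (V -> V)) : Prop :=
  exists f : gT -> V -> V,
    [/\ {in K &, forall x y, f (x * y)%g = f x \o f y},
        {in K &, injective f} & f @` [set` K] = G].

Definition fixed_points (G : set (V -> V)) : set V :=
  [set v | forall g, G g -> g v = v].

Definition closed_subspace (W : set V) : Prop :=
  [/\ W vac, forall a u v, W u -> W v -> W (a *: u + v) &
      forall u n v, W u -> W v -> W (vprod u n v)].

Definition generated_va (X : set V) : set V :=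
  [set v | forall W, closed_subspace W -> X `<=` W -> W v].

Definition generates (U X : set V) : Prop := generated_va X = U.

(** The vectors annihilated by all L(n), n >= 1, already form a subspace, so
    this is the span H of the highest weight vectors. *)
Definition highest_weight : set V :=
  [set v | forall n : int, 1 <= n -> Lop n v = 0].

End Notions.

Arguments Aut {C V}.
Arguments highest_weight {C V}.

(** * The lattice vertex operator algebra of Z alpha, (alpha, alpha) = 2 *)

(** V_L = S(h^-) (x) C[L].  The basis vector indexed by (m, k) is
    (prod_(i in m) alpha(-i-1)) (x) e^(k alpha): the element i of the multiset m
    stands for alpha(-i-1).  Since (beta, gamma) is even for all beta, gamma in L,
    the 2-cocycle on L may be taken trivial, so e_beta e^gamma = e^(beta+gamma). *)
Section Lattice.
Variable C : numFieldType.

Definition fock_index : choiceType := (multiset nat * int)%type.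
Definition fock : lmodType C := {freeg fock_index / C}.
Definition fock_basis (b : fock_index) : fock := << b >>.
Definition fock_vac : fock := fock_basis (mset0, 0).

(** alpha(n), with [alpha(m), alpha(n)] = 2 m delta_(m+n,0). *)
Definition heis (n : int) : fock -> fock :=
  fglift (fun b : fock_index => match n with
    | Posz 0    => (2 * b.2)%:~R *: fock_basis b
    | Posz i.+1 => (2 * i.+1 * b.1 i)%:R *: fock_basis ((b.1 `\ i)%mset, b.2)
    | Negz i    => fock_basis ((i +` b.1)%mset, b.2)
    end).

(** Coefficient of t^j in exp (sum_(n >= 1) a(n) t^n), expanded as
    sum_r 1/r! sum_(n_1 + ... + n_r = j) a(n_1) ... a(n_r). *)
Definition exp_coef (a : nat -> fock -> fock) (j : nat) (v : fock) : fock :=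
  \sum_(r < j.+1) r`!%:R^-1 *:
    \sum_(t : r.-tuple 'I_j.+1 | all (fun i : 'I_j.+1 => 0 < i)%N t &&
                                 (\sum_(i <- t) i == j)%N)
      foldr (fun i : 'I_j.+1 => a i) v t.

Definition exp_minus (k : int) : nat -> fock -> fock :=
  exp_coef (fun n v => (k%:~R / n%:R) *: heis (- n%:Z) v).

Definition exp_plus (k : int) : nat -> fock -> fock :=
  exp_coef (fun n v => (- k%:~R / n%:R) *: heis n%:Z v).

(** Coefficient of z^(-n-1) in Y(e^gamma, z), gamma = k alpha:
    exp(sum_(j>=1) gamma(-j)/j z^j) exp(- sum_(j>=1) gamma(j)/j z^(-j))
      e_gamma z^gamma,   where z^gamma acts on (m, l) as z^(2 k l). *)
Definition exp_field (k n : int) : fock -> fock :=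
  fglift (fun b : fock_index =>
    \sum_(p \in [set p : nat * nat |
                   p.1%:Z - p.2%:Z + 2 * k * b.2 = - n - 1])
      exp_minus k p.1 (exp_plus k p.2 (fock_basis (b.1, k + b.2)))).

(** Coefficient of z^(-n-1) in the normally ordered product
    : (1/i! (d/dz)^i alpha(z)) F(z) :, where alpha(z) = sum_n alpha(n) z^(-n-1)
    and F(z) = sum_n F(n) z^(-n-1); alpha(n) goes to the right for n >= 0. *)
Definition normal_prod (i : nat) (F : int -> fock -> fock)
    (n : int) (v : fock) : fock :=
  \sum_(j \in [set: nat]) 'C(i + j, i)%:R *:
     (heis (- (i + j).+1%:Z) (F (n + j%:Z) v)
      + (-1) ^+ i *: F (n - (i + j).+1%:Z) (heis j%:Z v)).

(** Y(alpha(-i_1-1)...alpha(-i_r-1) e^gamma, z) =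
    : (d^(i_1) alpha(z) / i_1!) ... (d^(i_r) alpha(z) / i_r!) Y(e^gamma, z) : *)
Definition fock_field (b : fock_index) : int -> fock -> fock :=
  foldr normal_prod (exp_field b.2) (enum_mset b.1).

Definition fock_prod (u : fock) (n : int) (v : fock) : fock :=
  fglift (fun b : fock_index => fock_field b n v) u.

Definition fock_conf : fock := 4%:R^-1 *: heis (-1) (heis (-1) fock_vac).

Definition VL2 : vertex_data C := VertexData fock_prod fock_vac fock_conf.

End Lattice.

(** * SL(2,C), binary forms and the identification of H with C[x,y]^+ *)

Section Forms.
Variable C : numFieldType.

Definition SL2 : set 'M[C]_2 := [set A | \det A = 1].

(** Algebra automorphism of C[x,y] extending the natural module C x + C y:
    the j-th variable goes to the j-th column of A. *)
Definition form_act (A : 'M[C]_2) (p : {mpoly C[2]}) : {mpoly C[2]} :=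
  p \mPo [tuple \sum_(i < 2) A i j *: 'X_i | j < 2].

Definition even_forms : set {mpoly C[2]} :=
  [set p | forall m, m \in msupp p -> ~~ odd (mdeg m)].

Definition form_invariants (K : set 'M[C]_2) : set {mpoly C[2]} :=
  [set p | forall A, K A -> form_act A p = p].

(** A = C[f_0, f_1, f_2], subject to the relation r = 0, with f_i homogeneous
    of degree d_i. *)
Definition presented_by (A : set {mpoly C[2]}) (d : 3.-tuple nat)
    (f : 3.-tuple {mpoly C[2]}) (r : {mpoly C[3]}) : Prop :=
  [/\ forall i : 'I_3, tnth f i \is (tnth d i).-homog,
      range (fun P : {mpoly C[3]} => P \mPo f) = A &
      forall P : {mpoly C[3]}, P \mPo f = 0 <-> exists Q, P = Q * r].

Definition rel_Alt4 : {mpoly C[3]} := 'X_0 ^+ 4 + 'X_1 ^+ 3 + 'X_2 ^+ 2.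
Definition rel_Sym4 : {mpoly C[3]} := 'X_2 ^+ 2 + 'X_0 ^+ 3 * 'X_1 + 'X_1 ^+ 3.
Definition rel_Alt5 : {mpoly C[3]} := 'X_0 ^+ 5 + 'X_1 ^+ 3 + 'X_2 ^+ 2.

Variable V : vertex_data C.

(** rho induces an isomorphism from PSL(2,C) = SL(2,C)/{1,-1} onto Aut(V). *)
Definition PSL2_iso_Aut (rho : 'M[C]_2 -> V -> V) : Prop :=
  [/\ rho @` SL2 = @Aut C V,
      forall A B, SL2 A -> SL2 B -> rho (A *m B) = rho A \o rho B &
      forall A, SL2 A -> (rho A = id <-> A = 1%:M \/ A = - 1%:M)].

(** phi matters only on H. *)
Definition identification (rho : 'M[C]_2 -> V -> V)
    (phi : V -> {mpoly C[2]}) : Prop :=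
  let H := @highest_weight C V in
  [/\ forall a u v, H u -> H v -> phi (a *: u + v) = a *: phi u + phi v,
      set_bij H even_forms phi,
      forall A v, SL2 A -> H v -> phi (rho A v) = form_act A (phi v) &
      forall m : nat,
        phi @` (H `&` [set v | weight_vector (m ^ 2)%N%:Z v]) =
        [set p | p \is (2 * m)%N.-homog]].

Definition preimage_SL2 (rho : 'M[C]_2 -> V -> V) (G : set (V -> V)) :
  set 'M[C]_2 := [set A | SL2 A /\ G (rho A)].

End Forms.

(* Main.v *)
Require Import Defs.
From mathcomp Require Import all_boot all_order all_algebra all_fingroup alt.
From mathcomp Require Import finmap multiset complex.
From mathcomp Require Import boolp classical_sets fsbigop reals.
From mathcomp Require Import freeg mpoly zify.

(** For n in Z let D_n be the span of the L(-k) V_(n-k), k >= 1.  The Fock space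
    V_L carries a positive definite Hermitian form for which alpha(n) and
    alpha(-n), hence L(n) and L(-n), are adjoint.  The orthogonal complement of
    D_n in V_n is therefore H_n = H `&` V_n, so V_n is the direct sum of H_n and
    D_n.  For forms p and q of degrees 2a and 2b, the component in H of
    phi^-1(p)_(-2ab-1) phi^-1(q) has weight (a+b)^2, so it defines an
    SL(2,C)-equivariant pairing with values in the forms of degree 2(a+b).  Such a
    pairing is a constant multiple of (p, q) |-> pq, and the constant is nonzero
    because e^(a alpha)_(-2ab-1) e^(b alpha) = e^((a+b) alpha).  Hence products of
    the v^i give phi^-1 of every monomial in the basic invariants modulo elements
    of some D_n.  Averaging over G expresses G-invariant elements of D_n by
    G-invariant vectors of smaller weight, and induction on the weight concludes. *)

Set Implicit Arguments.
Unset Strict Implicit.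
Unset Printing Implicit Defensive.

Import Order.TTheory GRing.Theory Num.Theory.

Local Open Scope classical_set_scope.
Local Open Scope ring_scope.

(** * Linearity for plain functions *)

Section LinearProp.
Variables (R : pzRingType) (U V : lmodType R) (f : U -> V).
Hypothesis f_lin : linear f.

Lemma lin0 : f 0 = 0.
Proof. by have := f_lin (-1) 0 0; rewrite scaler0 addr0 scaleN1r addNr. Qed.

Lemma linD u v : f (u + v) = f u + f v.
Proof. by rewrite -[u in LHS]scale1r f_lin scale1r. Qed.

Lemma linZ a u : f (a *: u) = a *: f u.
Proof. by rewrite -[a *: u]addr0 f_lin lin0 addr0. Qed.

Lemma linB u v : f (u - v) = f u - f v.
Proof. by rewrite addrC -scaleN1r f_lin scaleN1r addrC. Qed.

Lemma lin_sum I (r : seq I) (P : pred I) F :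
  f (\sum_(i <- r | P i) F i) = \sum_(i <- r | P i) f (F i).
Proof. by apply: (big_morph f linD lin0). Qed.

End LinearProp.

(** * The Hermitian form on the Fock space *)

Section FockForm.
Variable C : numClosedFieldType.
Implicit Types (u v w : fock C) (b : fock_index) (k n : int).

Lemma freegU_scale (c : C) b : << c *g b >> = c *: << b >> :> fock C.
Proof. by apply/eqP/freeg_eqP => x; rewrite coeffZ !coeffU mul1r. Qed.

Lemma fglift_linear (M : lmodType C) (f : fock_index -> M) : linear (fglift f).
Proof.
move=> a u v.
have fB : forall x y, fglift f (x - y) = fglift f x - fglift f y.
  exact: lift_is_additive.
have f0 : fglift f 0 = 0 by rewrite -[0 in LHS](subrr 0) fB subrr.
have fD x y : fglift f (x + y) = fglift f x + fglift f y.
  by rewrite -{1}[y]opprK fB -[- y]add0r fB f0 sub0r opprK.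
rewrite fD; congr (_ + _).
rewrite -(freeg_sumE u) scaler_sumr !(big_morph _ fD f0) scaler_sumr.
apply: eq_bigr => b _.
by rewrite freegU_scale scalerA -!freegU_scale !liftU scalerA.
Qed.

Lemma fglift_basis (M : lmodType C) (f : fock_index -> M) b :
  fglift f (fock_basis C b) = f b.
Proof. by rewrite liftU scale1r. Qed.

Lemma fock_ind (P : fock C -> Prop) :
    P 0 -> (forall a b u, P u -> P (a *: fock_basis C b + u)) ->
  forall u, P u.
Proof.
move=> P0 PD u; rewrite -(freeg_sumE u).
by elim: (dom u) => [|b s IHs]; rewrite ?big_nil // big_cons freegU_scale; apply: PD.
Qed.

Lemma heis_linear n : linear (@heis C n).
Proof. exact: fglift_linear. Qed.

Lemma heis_trunc u : exists N : nat, forall i, (N <= i)%N -> heis i%:Z u = 0.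
Proof.
elim/fock_ind: u => [|a b u [N uN]]; first by exists 0%N => i _; apply/lin0/heis_linear.
(* The inner successor makes the bound exceed every part [j]; the outer one is there because
   alpha(i+1) reads the multiplicity of [i], and it also excludes alpha(0). *)
exists (maxn N (\max_(j <- b.1 : multiset nat) j.+1).+1) => i.
rewrite geq_max => /andP[/uN ui]; case: i ui => // i ui bi.
rewrite heis_linear ui addr0 /heis fglift_basis.
suff -> : b.1 i = 0%N by rewrite muln0 scale0r scaler0.
apply/mset_eq0P; apply: contraL bi; move=> ib.
by rewrite -leqNgt (big_rem i) //= leq_max leqnn.
Qed.

(** These norms are forced by requiring alpha(n) and alpha(-n) to be adjoint. *)
Definition basis_norm b : C :=
  \prod_(i <- finsupp b.1) ((2 * i.+1) ^ b.1 i * (b.1 i)`!)%:R.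

Lemma basis_norm_gt0 b : 0 < basis_norm b.
Proof.
by rewrite /basis_norm; apply: prodr_gt0 => i _; rewrite ltr0n muln_gt0 expn_gt0 fact_gt0.
Qed.

(** The factor is the coefficient with which alpha(i+1) removes the part [i] again, so this
    recursion is the adjointness of alpha(-i-1) and alpha(i+1) on basis vectors. *)
Lemma basis_norm_add i (m : multiset nat) k :
  basis_norm ((i +` m)%mset, k) = (2 * i.+1 * (m i).+1)%:R * basis_norm (m, k).
Proof.
have normE (m' : multiset nat) : {subset finsupp m' <= (i |` finsupp m)%fset} ->
    basis_norm (m', k) =
    \prod_(j <- (i |` finsupp m)%fset) ((2 * j.+1) ^ m' j * (m' j)`!)%:R.
  move=> /fsubsetP sub; apply: big_fset_incl => // j _ /fsfun_dflt ->.
  by rewrite expn0.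
rewrite !normE => [|j|j mj]; first last.
- by rewrite !inE mj orbT.
- by rewrite !inE !mem_finsupp mset1DE; case: (j == i).
rewrite !(big_fsetD1 i (fset1U1 _ _)) /= mulrA; congr (_ * _).
  by rewrite mset1DE eqxx -natrM add1n expnS factS mulnACA.
apply: eq_big_seq => j; rewrite !inE => /andP[/negbTE ji _].
by rewrite mset1DE ji.
Qed.

Definition fock_form u v : C :=
  \sum_(b <- dom u) coeff b u * ((coeff b v)^* * basis_norm b).

(** The defining sum ranges over the support of [u], which varies with [u]; written as a lift from
    the basis, it is visibly linear in [u]. *)
Lemma fock_formE u v :
  fock_form u v = fglift (fun b => ((coeff b v)^* * basis_norm b : C^o)) u.
Proof.
have lin := fglift_linear (fun b => ((coeff b v)^* * basis_norm b : C^o)).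
rewrite -[in RHS](freeg_sumE u) (lin_sum lin); apply: eq_bigr => b _.
by rewrite liftU.
Qed.

Lemma fock_form_linear v : linear (fock_form^~ v : fock C -> C^o).
Proof. by move=> a u w; rewrite !fock_formE fglift_linear. Qed.

Lemma fock_form_basis b b' :
  fock_form (fock_basis C b) (fock_basis C b') = (b == b')%:R * basis_norm b.
Proof. by rewrite fock_formE fglift_basis coeffU mul1r conjC_nat eq_sym. Qed.

Lemma fock_form_semilinear u a v w :
  fock_form u (a *: v + w) = a^* * fock_form u v + fock_form u w.
Proof.
rewrite /fock_form mulr_sumr -big_split; apply: eq_bigr => b _ /=.
by rewrite coeffD coeffZ rmorphD rmorphM mulrDl mulrDr !mulrA (mulrC (a^*)).
Qed.

Lemma fock_form_conj u v : fock_form v u = (fock_form u v)^*.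
Proof.
have form0 w : fock_form w 0 = 0.
  by rewrite /fock_form big1 // => b _; rewrite coeff0 conjC0 mul0r mulr0.
elim/fock_ind: u => [|a b u IHu].
  by rewrite form0 (lin0 (fock_form_linear v)) conjC0.
rewrite fock_form_semilinear IHu fock_form_linear rmorphD rmorphM /=.
congr (_ * _ + _); elim/fock_ind: v {IHu} => [|c b' v IHv].
  by rewrite form0 conjC0; exact: lin0 (fock_form_linear _).
rewrite fock_form_semilinear fock_form_linear IHv rmorphD rmorphM /= conjCK.
congr (_ * _ + _); rewrite !fock_form_basis eq_sym rmorphM /= conjC_nat.
by case: eqVneq => [->|]; rewrite ?mul0r // geC0_conj // ltW // basis_norm_gt0.
Qed.

Lemma fock_formZl a u v : fock_form (a *: u) v = a * fock_form u v.
Proof. exact: (linZ (fock_form_linear v)). Qed.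

Lemma fock_formZr a u v : fock_form u (a *: v) = a^* * fock_form u v.
Proof. by rewrite fock_form_conj fock_formZl rmorphM /= -fock_form_conj. Qed.

Lemma fock_form_eq0 u : fock_form u u = 0 -> u = 0.
Proof.
move=> uu0; apply/eqP; rewrite -dom_eq0; apply: contra_eqT uu0 => u_neq0.
have ge0 b : 0 <= coeff b u * ((coeff b u)^* * basis_norm b).
  by rewrite mulrA mulr_ge0 ?mul_conjC_ge0 // ltW // basis_norm_gt0.
rewrite /fock_form; case: (dom u) (fun b => mem_dom u b) u_neq0 => // b s /(_ b) mem_b _.
rewrite big_cons gt_eqF // ltr_wpDr ?sumr_ge0 //.
by rewrite mulrA mulr_gt0 ?mul_conjC_gt0 ?basis_norm_gt0 // -mem_b mem_head.
Qed.

(** Conjugate symmetry reduces this to n <= 0, where the operator is alpha(0), diagonal with integer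
    eigenvalues, or creates a single part, and [basis_norm_add] compares the norms. *)
Lemma heis_adjoint n u v : fock_form (heis n u) v = fock_form u (heis (- n) v).
Proof.
suff adj_le0 m x y : m <= 0 -> fock_form (heis m x) y = fock_form x (heis (- m) y).
  have [/adj_le0 //|n_gt0] := lerP n 0.
  rewrite fock_form_conj [RHS]fock_form_conj adj_le0 ?opprK // oppr_le0 ltW //.
move=> m_le0; elim/fock_ind: x => [|a b x IHx].
  by rewrite (lin0 (@heis_linear m)) !(lin0 (fock_form_linear _)).
rewrite heis_linear !fock_form_linear IHx; congr (_ * _ + _).
elim/fock_ind: y {IHx} => [|c b' y IHy].
  by rewrite (lin0 (@heis_linear (- m))) ![fock_form _ 0]fock_form_conj
    !(lin0 (fock_form_linear _)).
rewrite heis_linear !fock_form_semilinear IHy; congr (_ * _ + _).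
rewrite /heis !fglift_basis.
case: m m_le0 {IHy} => [[|i]|i] //= _; rewrite ?oppr0.
- rewrite fock_formZl fock_formZr -[_^*]/(Num.conj _) rmorph_int !fock_form_basis.
  by case: eqVneq => [->|] //; rewrite !mul0r !mulr0.
- rewrite fock_formZr conjC_nat !fock_form_basis.
  case: b b' => [m k] [m' k'] /=; rewrite !xpair_eqE.
  have [_|] := eqVneq k k'; last by rewrite !andbF !mul0r mulr0.
  rewrite !andbT; have [<-|neq_m] := eqVneq _ m'.
    by rewrite mset1DE eqxx add1n msetD1K eqxx !mul1r basis_norm_add.
  (* The left side is now 0. On the right, either [i] is not in [m'] and the coefficient vanishes,
     or adding [i] back to [m] gives [m'], which is excluded. *)
  rewrite mul0r; case: eqVneq => [def_m|]; last by rewrite mul0r mulr0.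
  have [->|] := eqVneq (m' i) 0%N; first by rewrite muln0 mul0r.
  by rewrite mset_neq0 => im'; rewrite def_m msetB1K ?eqxx in neq_m.
Qed.

End FockForm.

(** * Modes of the vertex operators of V_L and its Virasoro operators *)

Section FockFields.
Variable C : numClosedFieldType.
Implicit Types (u v w : fock C) (b : fock_index) (k n : int).

(** Every nonempty product of modes kills [v], so only the empty product, of degree 0, survives. *)
Lemma exp_coef_vanish (a : nat -> fock C -> fock C) j v :
    (forall i, (0 < i <= j)%N -> a i v = 0) -> (forall i, a i 0 = 0) ->
  exp_coef a j v = if j == 0%N then v else 0.
Proof.
move=> av a0.
have fold0 (t : seq 'I_j.+1) : all (fun i : 'I_j.+1 => 0 < i)%N t -> t != [::] ->
    foldr (fun i : 'I_j.+1 => a i) v t = 0.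
  (* The last entry of the tuple is the operator applied first. *)
  case/lastP: t => // t i; rewrite all_rcons => /andP[i_gt0 _] _.
  have ai : a i v = 0 by apply: av; rewrite i_gt0 -ltnS ltn_ord.
  by rewrite foldr_rcons ai; elim: t => //= i' t ->.
rewrite /exp_coef big_ord_recl /= fact0 invr1 scale1r [X in _ + X]big1 => [|r _].
  rewrite addr0 (eq_bigr (fun=> v)) => [|t _]; last by rewrite (tuple0 t).
  have [->|/negbTE j0] := eqVneq j 0%N.
    rewrite (big_pred1 [tuple]) // => t; rewrite (tuple0 t) /= big_nil.
    by rewrite [RHS]eqxx.
  by rewrite big_pred0 // => t; rewrite (tuple0 t) /= big_nil eq_sym j0.
rewrite big1 ?scaler0 // => t /andP[/fold0 t0 _]; apply: t0.
by rewrite -size_eq0 size_tuple.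
Qed.

Lemma exp_minus0 k j : exp_minus k j (0 : fock C) = 0.
Proof.
rewrite /exp_minus exp_coef_vanish ?if_same // => [i _|i].
all: by rewrite (lin0 (@heis_linear _ _)) scaler0.
Qed.

(** For k = 0 both exponentials reduce to their constant terms, so only the index (0, 0)
    contributes, and its constraint reads n = -1. *)
Lemma exp_field0 n v : exp_field 0 n v = if n == -1 then v else 0.
Proof.
elim/fock_ind: v => [|a b v IHv].
  by rewrite /exp_field (lin0 (fglift_linear _)) if_same.
rewrite /exp_field fglift_linear fglift_basis [fglift _ v]IHv.
have exp_m j u : exp_minus 0 j u = if j == 0%N then u else 0.
  by rewrite /exp_minus exp_coef_vanish // => *; rewrite mul0r scale0r.
have exp_p j u : exp_plus 0 j u = if j == 0%N then u else 0.
  by rewrite /exp_plus exp_coef_vanish // => *; rewrite oppr0 mul0r scale0r.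
under eq_fsbigr do rewrite exp_m exp_p add0r -surjective_pairing.
case: (eqVneq n (-1)) => [->|n_neq]; last first.
  rewrite fsbig1 ?scaler0 ?addr0 // => -[[|p] [|q]] //=.
  by move/eqP; rewrite mulr0 mul0r subrr ?addr0 -opprD eq_sym oppr_eq0 addr_eq0
    (negbTE n_neq).
congr (_ *: _ + _).
rewrite -(fsbig_widen [set (0%N, 0%N)]) => [|_ -> //|[[|p] [|q]]] //=.
- by rewrite fsbig_set1.
- by rewrite mulr0 mul0r.
- by case.
Qed.

Lemma heis_vac_gt0 (i : nat) k : (0 < i)%N -> heis i%:Z (fock_basis C (mset0, k)) = 0.
Proof. by case: i => // i _; rewrite /heis fglift_basis mset0E muln0 scale0r. Qed.

Lemma fock_prod_basis b n v : fock_prod (fock_basis C b) n v = fock_field b n v.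
Proof. by rewrite /fock_prod fglift_basis. Qed.

(** The annihilating exponential fixes e^((k+l) alpha), which forces q = 0; the exponent of z, here
    the lowest one 2kl, then forces p = 0. *)
Lemma fock_prod_exp k l :
  fock_prod (fock_basis C (mset0, k)) (- (2 * k * l) - 1) (fock_basis C (mset0, l)) =
  fock_basis C (mset0, k + l).
Proof.
rewrite fock_prod_basis /fock_field /= enum_mset0 /= /exp_field fglift_basis /=.
have exp_p j : exp_plus k j (fock_basis C (mset0, k + l)) =
    if j == 0%N then fock_basis C (mset0, k + l) else 0.
  rewrite /exp_plus exp_coef_vanish // => i; last first.
    by rewrite (lin0 (@heis_linear _ _)) scaler0.
  by move=> /andP[/heis_vac_gt0 -> _]; rewrite scaler0.
under eq_fsbigr do rewrite exp_p.
rewrite -(fsbig_widen [set (0%N, 0%N)]) => [|_ -> /=|[p q] /= [+ pq]] //=.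
- rewrite fsbig_set1 /= /exp_minus exp_coef_vanish // => i.
  + by rewrite leqn0 => /andP[i_gt0 /eqP i0]; rewrite i0 in i_gt0.
  + by rewrite (lin0 (@heis_linear _ _)) scaler0.
- by rewrite opprD opprK addrK subrr add0r.
- case: q pq => [|q] pq; last by rewrite exp_minus0.
  rewrite subr0 opprD !opprK addrK => /(congr1 (fun x => x - 2 * k * l)).
  by rewrite addrK subrr => -[p0]; rewrite p0 in pq.
Qed.

(** With the identity field as second factor a single summand survives: j = n if n >= 0, and j =
    -n-1 if n < 0. *)
Lemma normal_prod_heis n v : normal_prod 0 (exp_field 0) n v = heis n v.
Proof.
have h0 k : heis k (0 : fock C) = 0 by exact: lin0 (@heis_linear C k).
rewrite /normal_prod; under eq_fsbigr => j _ do
  rewrite bin0 scale1r add0n expr0 scale1r !exp_field0 ?(fun_if (heis _)) ?h0.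
have ifE (p q : bool) (x y : fock C) : p = false -> q = false ->
  (if p then x else 0) + (if q then y else 0) = 0 by move=> -> ->; rewrite addr0.
have [n_ge0|n_lt0] := lerP 0 n.
  rewrite -(fsbig_widen [set `|n|%N]) => [|//|j [_ /= /eqP jn]]; last by apply: ifE; lia.
  have nE : `|n|%N%:Z = n by lia.
  rewrite fsbig_set1 nE ifN ?add0r ?ifT //; lia.
rewrite -(fsbig_widen [set `|n|.-1]) => [|//|j [_ /= /eqP jn]]; last by apply: ifE; lia.
have nE : - `|n|.-1.+1%:Z = n by lia.
by rewrite fsbig_set1 nE ifT ?ifN ?addr0 //; lia.
Qed.

Lemma heis2_vac : heis (-1) (heis (-1) (fock_vac C)) =
  fock_basis C ((0%N +` (0%N +` mset0))%mset, 0).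
Proof. by rewrite /fock_vac /heis !fglift_basis. Qed.

(** The field of omega is a quarter of the normally ordered square of alpha(z); beyond [M] all terms
    of the mode n+1 vanish on [v]. *)
Lemma Lop_fock n v (M : nat) :
    (forall j, (M <= j)%N -> heis j%:Z v = 0 /\ heis (n + 1 + j%:Z) v = 0) ->
  Lop n (v : VL2 C) = 4%:R^-1 *: \sum_(j < M)
    (heis (- j.+1%:Z) (heis (n + j.+1%:Z) v) + heis (n - j%:Z) (heis j%:Z v)).
Proof.
have h0 k : heis k (0 : fock C) = 0 by exact: lin0 (@heis_linear C k).
move=> vM; rewrite /Lop /= /fock_conf heis2_vac /fock_prod.
rewrite (linZ (fglift_linear _)) fglift_basis; congr (_ *: _).
rewrite /fock_field.
have -> : (0%N +` (0%N +` mset0))%mset = msetn 2 0%N.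
  by apply/msetP => i; rewrite !mset1DE mset0E msetnE addn0; case: (i == 0%N).
rewrite /= enum_msetn.
rewrite /= {1}/normal_prod.
under eq_fsbigr => j _ do rewrite bin0 scale1r add0n expr0 scale1r !normal_prod_heis.
rewrite -(fsbig_widen `I_M) => [|//|j [_ /= /negP]]; last first.
  by rewrite -leqNgt => /vM[-> ->]; rewrite !h0 addr0.
rewrite -fsbig_ord; apply: eq_bigr => j _.
by congr (heis _ (heis _ v) + heis _ _); lia.
Qed.

(** alpha(0) is the scalar 2k on charge k, and every mode preserves the charge. *)
Lemma heis0_comm n v : heis n (heis 0 v) = heis 0 (heis n v).
Proof.
elim/fock_ind: v => [|a b v IHv]; first by rewrite !(lin0 (@heis_linear C _)).
rewrite !heis_linear IHv; congr (_ *: _ + _).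
rewrite /heis !fglift_basis (linZ (fglift_linear _)) fglift_basis.
case: n {IHv} => [[|i]|i]; rewrite ?(linZ (fglift_linear _)) ?fglift_basis //.
by rewrite scalerA mulrC -scalerA.
Qed.

Lemma Lop_adjoint n u v :
  fock_form (Lop n (u : VL2 C)) v = fock_form u (Lop (- n) (v : VL2 C)).
Proof.
have [Nu uN] := heis_trunc u; have [Nv vN] := heis_trunc v.
have u0 k : Nu%:Z <= k -> heis k u = 0.
  by move=> Nk; have -> : k = `|k|%N%:Z; [lia|apply: uN; lia].
have v0 k : Nv%:Z <= k -> heis k v = 0.
  by move=> Nk; have -> : k = `|k|%N%:Z; [lia|apply: vN; lia].
(* Both sides are sums over j < M of normally ordered terms; they differ by the
   shift j |-> j.+1, so the sums telescope. *)
have [M leM] : exists M, (Nu + Nv + `|n|.+1 <= M)%N by exists (Nu + Nv + `|n|.+1)%N.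
rewrite (@Lop_fock n u M) => [|j jM]; last by split; apply: u0; lia.
rewrite (@Lop_fock (- n) v M) => [|j jM]; last by split; apply: v0; lia.
rewrite fock_formZl fock_formZr geC0_conj ?invr_ge0 ?ler0n //; congr (_ * _).
pose A (j : nat) := fock_form u (heis (- n - j%:Z) (heis j%:Z v)).
pose B (j : nat) := fock_form u (heis (- j%:Z) (heis (- n + j%:Z) v)).
have formDr x y : fock_form u (x + y) = fock_form u x + fock_form u y.
  by rewrite -[x]scale1r fock_form_semilinear conjC1 mul1r scale1r.
have form0r : fock_form u 0 = 0 by rewrite -(scale0r 0) fock_formZr conjC0 mul0r.
rewrite (lin_sum (fock_form_linear v)) (big_morph _ formDr form0r).
rewrite (eq_bigr (fun j : 'I_M => A j.+1 + B j)) => [|j _]; last first.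
  rewrite (linD (fock_form_linear _)) !heis_adjoint.
  by congr (fock_form _ (heis _ (heis _ _)) + fock_form _ (heis _ (heis _ _))); lia.
rewrite [RHS](eq_bigr (fun j : 'I_M => B j.+1 + A j)) => [|j _]; last first.
  by rewrite formDr.
rewrite !big_split /=.
have shift (F : nat -> C) : F M = 0 -> \sum_(j < M) F j.+1 = \sum_(j < M) F j - F 0%N.
  move=> FM; have <- : \sum_(j < M.+1) F j = \sum_(j < M) F j.
    by rewrite big_ord_recr /= FM addr0.
  by rewrite big_ord_recl addrC addKr.
(* The boundary terms at [M] vanish by the choice of [M]; those at 0 agree because alpha(0) commutes
   with alpha(-n). *)
have AM : A M = 0 by rewrite /A v0 ?(lin0 (@heis_linear C _)) //; lia.
have BM : B M = 0 by rewrite /B v0 ?(lin0 (@heis_linear C _)) //; lia.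
have AB : A 0%N = B 0%N by rewrite /A /B (subr0 (- n)) heis0_comm.
by rewrite !shift // AB addrAC [RHS]addrAC [in RHS](addrC (\sum_(i < M) B i)).
Qed.

(** All positive modes kill e^(k alpha), so one summand suffices, and for n = 0 the eigenvalue is
    (2k)^2 / 4. *)
Lemma Lop_exp (k : int) n : 0 <= n ->
  Lop n (fock_basis C (mset0, k) : VL2 C) =
  if n == 0 then (k ^+ 2)%:~R *: fock_basis C (mset0, k) else 0.
Proof.
have h0 m : heis m (0 : fock C) = 0 by exact: lin0 (@heis_linear C m).
have hgt0 m : 0 < m -> heis m (fock_basis C (mset0, k)) = 0.
  by move=> m_gt0; have -> : m = `|m|%N%:Z; [lia|apply: heis_vac_gt0; lia].
move=> n_ge0; rewrite (@Lop_fock _ _ 1%N) => [|j jM]; last first.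
  by split; apply: hgt0; lia.
rewrite big_ord1 /= hgt0 ?h0 ?add0r; last by lia.
have heis0 : heis 0 (fock_basis C (mset0, k)) = (2 * k)%:~R *: fock_basis C (mset0, k).
  by rewrite /heis fglift_basis.
rewrite heis0 (linZ (@heis_linear C _)) subr0.
case: eqVneq => [->|n0]; last by rewrite hgt0 ?scaler0 //; lia.
rewrite heis0 !scalerA.
rewrite -intrM mulrC; congr (_ *: _).
have -> : 2 * k * (2 * k) = k ^+ 2 * 4 by rewrite expr2; lia.
by rewrite intrM mulfK // pnatr_eq0.
Qed.

End FockFields.

(** * Equivariant pairings of binary forms *)

Section BinaryForms.
Variable C : numFieldType.
Implicit Types (p q r : {mpoly C[2]}) (M N : nat).

Local Notation "'x" := ('X_0 : {mpoly C[2]}).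
Local Notation "'y" := ('X_1 : {mpoly C[2]}).

Definition bimonom N k : {mpoly C[2]} := 'x ^+ k * 'y ^+ (N - k).

Lemma mpolyX2 (m : 'X_{1..2}) : 'X_[m] = bimonom (mdeg m) (m 0).
Proof.
rewrite mpolyXE_id mdegE !big_ord_recl !big_ord0 mulr1 addn0 /bimonom addKn.
by have -> : fintype.lift ord0 ord0 = 1 :> 'I_2 by apply: val_inj.
Qed.

Lemma bimonom_homog N k : (k <= N)%N -> bimonom N k \is N.-homog.
Proof.
move=> kN; have X_homog (i : 'I_2) n : ('X_i : {mpoly C[2]}) ^+ n \is n.-homog.
  by rewrite -[X in X.-homog]mul1n dhomogMn // dhomogX /= mdeg1.
by rewrite -{2}(subnKC kN) dhomogM.
Qed.

(** Partial sums of the monomial expansion stay homogeneous, so maps controlled only on homogeneous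
    forms can be treated monomial by monomial. *)
Lemma homog_ind N (P : {mpoly C[2]} -> Prop) :
    P 0 ->
    (forall a k p, (k <= N)%N -> p \is N.-homog -> P p -> P (a *: bimonom N k + p)) ->
  forall p, p \is N.-homog -> P p.
Proof.
move=> P0 PD p /dhomogP p_homog; rewrite (mpolyE p).
suff: P (\sum_(m <- msupp p) p@_m *: 'X_[m]) /\
    \sum_(m <- msupp p) p@_m *: 'X_[m] \is N.-homog by case.
elim: (msupp p) p_homog => [|m s IHs] s_homog; first by rewrite big_nil dhomog0.
have sN : {in s, forall m, mdeg m = N}.
  by move=> m' m's; apply: s_homog; rewrite inE m's orbT.
have mN : mdeg m = N by apply: s_homog; rewrite mem_head.
have [Ps hs] := IHs sN; rewrite big_cons mpolyX2 mN.
have kN : (m 0%R <= N)%N by rewrite -mN mdegE big_ord_recl leq_addr.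
split; first exact: PD.
by rewrite dhomogD ?dhomogZ // bimonom_homog.
Qed.

Lemma form_act_linear A : linear (@form_act C A).
Proof. by move=> a p q; rewrite /form_act linearP. Qed.

Lemma form_actM A p q : form_act A (p * q) = form_act A p * form_act A q.
Proof. by rewrite /form_act rmorphM. Qed.

Lemma form_actX A p k : form_act A (p ^+ k) = form_act A p ^+ k.
Proof. by rewrite /form_act rmorphXn. Qed.

Lemma form_act_var (A : 'M[C]_2) (j : 'I_2) :
  form_act A 'X_j = \sum_(i < 2) A i j *: 'X_i.
Proof. by rewrite /form_act comp_mpolyXU -tnth_nth tnth_mktuple. Qed.

Lemma form_act_bimonom (A : 'M[C]_2) N k :
  form_act A (bimonom N k) =
  (A 1 0 *: 'y + A 0 0 *: 'x) ^+ k * (A 1 1 *: 'y + A 0 1 *: 'x) ^+ (N - k).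
Proof.
rewrite /bimonom form_actM !form_actX !form_act_var !big_ord_recl !big_ord0 !addr0.
have -> : fintype.lift ord0 ord0 = 1 :> 'I_2 by apply: val_inj.
by congr (_ ^+ _ * _ ^+ _); apply: addrC.
Qed.

(** Sends x to x + y and fixes y, hence acts unitriangularly on the monomials of a given degree. *)
Definition shear : 'M[C]_2 := \matrix_(i < 2, j < 2) (j <= i)%N%:R.
(** Sends x to 2x and y to y/2; this torus element has distinct eigenvalues on the monomials of a
    given degree. *)
Definition dilation : 'M[C]_2 :=
  \matrix_(i < 2, j < 2) if i == j then if i == 0 then 2 else 2^-1 else 0.

Lemma SL2_shear : @SL2 C shear.
Proof.
rewrite /SL2 /= det_trig; last first.
  by apply/is_trig_mxP => i j ij; rewrite mxE leqNgt ij.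
by rewrite !big_ord_recl big_ord0 !mxE !leqnn !mulr1.
Qed.

Lemma SL2_dilation : @SL2 C dilation.
Proof.
rewrite /SL2 /= det_trig; last first.
  by apply/is_trig_mxP => i j ij; rewrite mxE ifN // neq_ltn ij.
by rewrite !big_ord_recl big_ord0 !mxE /= mulr1 mulfV // pnatr_eq0.
Qed.

Lemma shear_bimonom N k : (k <= N)%N ->
  form_act shear (bimonom N k) = \sum_(i < k.+1) 'C(k, i)%:R *: bimonom N i.
Proof.
move=> kN; rewrite form_act_bimonom !mxE /= !scale1r scale0r addr0.
rewrite exprDn mulr_suml; apply: eq_bigr => i _.
rewrite scaler_nat mulrnAl mulrAC -exprD mulrC; congr (_ * _ ^+ _ *+ _).
by have := ltn_ord i; lia.
Qed.

Lemma dilation_bimonom N k :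
  form_act dilation (bimonom N k) = (2 ^+ k / 2 ^+ (N - k)) *: bimonom N k.
Proof.
rewrite form_act_bimonom !mxE /= !scale0r add0r addr0.
by rewrite !exprZn -scalerAl -scalerAr scalerA exprVn.
Qed.

Lemma mcoeff_dilation p (m : 'X_{1..2}) :
  (form_act dilation p)@_m = 2 ^+ m 0 / 2 ^+ (mdeg m - m 0) * p@_m.
Proof.
rewrite {1}(mpolyE p) (lin_sum (form_act_linear _)) [in RHS](mpolyE p) !raddf_sum.
rewrite mulr_sumr; apply: eq_bigr => m' _ /=.
rewrite (linZ (form_act_linear _)) {1}mpolyX2 dilation_bimonom -mpolyX2.
rewrite !mcoeffZ mcoeffX; case: eqVneq => [->|_]; last by rewrite !mulr0.
by rewrite !mulr1 mulrC.
Qed.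

Lemma dilation_eigenform K t r : (t <= K)%N -> r \is K.-homog ->
    form_act dilation r = (2 ^+ t / 2 ^+ (K - t)) *: r ->
  exists c, r = c *: bimonom K t.
Proof.
(* All monomials in the support of [r] turn out to equal x^t y^(K-t), so the sum of the coefficients
   is the right scalar. *)
move=> tK /dhomogP r_homog r_eigen; exists (\sum_(m <- msupp r) r@_m).
rewrite {1}(mpolyE r) scaler_suml; apply: eq_big_seq => m m_r.
have mK : mdeg m = K by apply: r_homog.
have kK : (m 0%R <= K)%N by rewrite -mK mdegE big_ord_recl leq_addr.
rewrite mpolyX2 mK; congr (_ *: bimonom K _).
have /(congr1 (mcoeff m)) := r_eigen; rewrite mcoeff_dilation mcoeffZ mK.
(* Multiplied by 2^K, the eigenvalues become the powers 4^j, which are distinct. *)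
move/(mulIf _); rewrite -mcoeff_msupp m_r => /(_ isT)/(congr1 ( *%R (2 ^+ K))).
have powE j : (j <= K)%N -> 2 ^+ K * (2 ^+ j / 2 ^+ (K - j)) = (2 ^ (j + j))%:R :> C.
  move=> jK; rewrite mulrCA -[in 2 ^+ K](subnKC jK) exprD mulfK.
    by rewrite -exprD natrX.
  by rewrite expf_neq0 // pnatr_eq0.
by rewrite !powE // => /eqP; rewrite eqr_nat eqn_exp2l // => /eqP; lia.
Qed.

Section Pairing.
Variables (M N : nat) (B : {mpoly C[2]} -> {mpoly C[2]} -> {mpoly C[2]}).

(** All conditions are restricted to fixed degrees, because the pairing of interest is built from
    [psi], whose linearity is stated degree by degree. *)
Definition equivariant_pairing :=
  [/\ forall a p p' q, p \is M.-homog -> p' \is M.-homog -> q \is N.-homog ->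
        B (a *: p + p') q = a *: B p q + B p' q,
      forall a p q q', p \is M.-homog -> q \is N.-homog -> q' \is N.-homog ->
        B p (a *: q + q') = a *: B p q + B p q',
      forall p q, p \is M.-homog -> q \is N.-homog -> B p q \is (M + N).-homog &
      forall A p q, SL2 A -> p \is M.-homog -> q \is N.-homog ->
        B (form_act A p) (form_act A q) = form_act A (B p q)].

Hypothesis B_pairing : equivariant_pairing.

Lemma pairing0l q : q \is N.-homog -> B 0 q = 0.
Proof.
have [B_linl _ _ _] := B_pairing => hq.
have := B_linl (-1) 0 0 q (dhomog0 _ _ _) (dhomog0 _ _ _) hq.
by rewrite scaler0 addr0 scaleN1r addNr.
Qed.

Lemma pairing0r p : p \is M.-homog -> B p 0 = 0.
Proof.
have [_ B_linr _ _] := B_pairing => hp.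
have := B_linr (-1) p 0 0 hp (dhomog0 _ _ _) (dhomog0 _ _ _).
by rewrite scaler0 addr0 scaleN1r addNr.
Qed.

Lemma pairingZ a b p q : p \is M.-homog -> q \is N.-homog ->
  B (a *: p) (b *: q) = (a * b) *: B p q.
Proof.
have [B_linl B_linr _ _] := B_pairing => hp hq.
rewrite -[a *: p]addr0 B_linl ?dhomog0 ?dhomogZ // pairing0l ?dhomogZ // addr0.
by rewrite -[b *: q]addr0 B_linr ?dhomog0 // pairing0r // addr0 scalerA.
Qed.

End Pairing.

Lemma bimonom_sum_homog K k (c : nat -> C) : (k <= K.+1)%N ->
  \sum_(i < k) c i *: bimonom K i \is K.-homog.
Proof.
move=> kK; apply: rpred_sum => i _; rewrite dhomogZ // bimonom_homog //.
by have := ltn_ord i; lia.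
Qed.

(** The dilation forces B to send a pair of monomials with exponents i and j of x to
    a multiple of the monomial with exponent i + j of x.  By induction on i + j, the
    shear fixes this multiple, but it fixes no such monomial if i + j > 0. *)
Lemma equivariant_pairing_eq0 M N B : equivariant_pairing M N B ->
    B (bimonom M 0) (bimonom N 0) = 0 ->
  forall p q, p \is M.-homog -> q \is N.-homog -> B p q = 0.
Proof.
move=> B_pairing B00; have [B_linl B_linr B_homog B_act] := B_pairing.
have B0l := pairing0l B_pairing; have B0r := pairing0r B_pairing.
suff B_mono i j : (i <= M)%N -> (j <= N)%N -> B (bimonom M i) (bimonom N j) = 0.
  move=> p q hp hq; elim/homog_ind: p / hp => [|a k p kM hp Bp]; first exact: B0l.
  rewrite B_linl ?bimonom_homog // Bp addr0.
  elim/homog_ind: q / hq {Bp} => [|b l q lN hq Bq].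
    by rewrite B0r ?scaler0 ?bimonom_homog.
  by rewrite B_linr ?bimonom_homog // scalerDr Bq addr0 B_mono // !scaler0.
have BZ := pairingZ B_pairing.
have B_suml k (c : nat -> C) q : (k <= M.+1)%N -> q \is N.-homog ->
    B (\sum_(i < k) c i *: bimonom M i) q = \sum_(i < k) c i *: B (bimonom M i) q.
  move=> + hq; elim: k => [|k IHk] kM; first by rewrite !big_ord0 B0l.
  rewrite !big_ord_recr /= addrC B_linl ?bimonom_homog ?bimonom_sum_homog // ?(ltnW kM) //.
  by rewrite IHk 1?addrC // ltnW.
have B_sumr k (c : nat -> C) p : (k <= N.+1)%N -> p \is M.-homog ->
    B p (\sum_(i < k) c i *: bimonom N i) = \sum_(i < k) c i *: B p (bimonom N i).
  move=> + hp; elim: k => [|k IHk] kN; first by rewrite !big_ord0 B0r.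
  rewrite !big_ord_recr /= addrC B_linr ?bimonom_homog ?bimonom_sum_homog // ?(ltnW kN) //.
  by rewrite IHk 1?addrC // ltnW.
have [n] := ubnP (i + j); elim: n i j => // n IHn i j ij iM jN.
have [ij0|ij_gt0] := posnP (i + j).
  by have [-> ->] : i = 0%N /\ j = 0%N by lia.
set r := B _ _.
have hi := bimonom_homog iM; have hj := bimonom_homog jN.
have r_homog : r \is (M + N).-homog by apply: B_homog.
have [] := dilation_eigenform _ r_homog (t := (i + j)%N); first by lia.
  rewrite -(B_act _ _ _ SL2_dilation) // !dilation_bimonom BZ // mulf_div -!exprD.
  by congr ((_ / 2 ^+ _) *: _); lia.
move=> c def_r.
have r_shear : form_act shear r = r.
  rewrite -(B_act _ _ _ SL2_shear) // !shear_bimonom //.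
  rewrite (B_suml _ (fun a => 'C(i, a)%:R)) //; last first.
    exact: (bimonom_sum_homog (fun b => 'C(j, b)%:R)).
  have B_sum a : (a <= M)%N ->
      B (bimonom M a) (\sum_(b < j.+1) 'C(j, b)%:R *: bimonom N b) =
      \sum_(b < j.+1) 'C(j, b)%:R *: B (bimonom M a) (bimonom N b).
    by move=> aM; apply: (B_sumr _ (fun b => 'C(j, b)%:R)); rewrite ?bimonom_homog.
  (* Every pair other than (i, j) has a smaller sum of exponents and vanishes by induction; the pair
     (i, j) has coefficient 1. *)
  rewrite big_ord_recr /= binn scale1r B_sum //.
  rewrite [X in X + _]big1 ?add0r => [|a _].
    rewrite big_ord_recr /= binn scale1r big1 ?add0r // => b _.
    by rewrite IHn ?scaler0 //; have := ltn_ord b; lia.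
  rewrite B_sum ?big1 ?scaler0 // => [b _|]; last by have := ltn_ord a; lia.
  by rewrite IHn ?scaler0 //; have := ltn_ord a; have := ltn_ord b; lia.
move: r_shear; rewrite def_r (linZ (form_act_linear _)) form_act_bimonom !mxE /=.
rewrite !scale1r scale0r addr0.
(* At x = 0, y = 1 the sheared monomial takes the value 1 and the monomial itself the value 0, since
   i + j > 0; hence c = 0. *)
move/(congr1 (meval (fun k : 'I_2 => (k == 1)%:R))).
rewrite !mevalZ /bimonom !rmorphM !rmorphXn /= !mevalD !mevalXU /=.
rewrite addr0 expr0n !expr1n !mulr1 gtn_eqF // mulr0 => ->.
by rewrite scale0r.
Qed.

(** By the dilation, B(y^M, y^N) is a multiple c of y^(M+N). Subtracting c times the product leaves
    an equivariant pairing that vanishes on (y^M, y^N). *)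
Lemma equivariant_pairingP M N B : equivariant_pairing M N B ->
  exists c, forall p q, p \is M.-homog -> q \is N.-homog -> B p q = c *: (p * q).
Proof.
move=> B_pairing; have [B_linl B_linr B_homog B_act] := B_pairing.
have h0 K : bimonom K 0 \is K.-homog by apply: bimonom_homog.
have BZ := pairingZ B_pairing.
have B00 : exists c, B (bimonom M 0) (bimonom N 0) = c *: bimonom (M + N) 0.
  apply: dilation_eigenform; rewrite ?B_homog // -(B_act _ _ _ SL2_dilation) //.
  by rewrite !dilation_bimonom BZ // mulf_div -!exprD !subn0.
have [c def_c] := B00; exists c => p q hp hq; apply/eqP; rewrite -subr_eq0; apply/eqP.
apply: (@equivariant_pairing_eq0 M N (fun p q => B p q - c *: (p * q))) => //.
  split.
  - move=> a p1 p2 q1 h1 h2 hq1; rewrite B_linl // mulrDl -scalerAl !scalerDr.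
    by rewrite opprD addrACA scalerA mulrC -scalerA scalerN.
  - move=> a p1 q1 q2 hp1 h1 h2; rewrite B_linr // mulrDr -scalerAr !scalerDr.
    by rewrite opprD addrACA scalerA mulrC -scalerA scalerN.
  - by move=> p1 q1 h1 h2; rewrite rpredB ?B_homog // dhomogZ // dhomogM.
  - move=> A p1 q1 hA h1 h2; rewrite B_act // (linB (form_act_linear _)).
    by rewrite (linZ (form_act_linear _)) form_actM.
rewrite def_c /bimonom !expr0 !mul1r !subn0 -exprD subrr //.
Qed.

End BinaryForms.

(** * Weights and Virasoro descendants *)

Section OrthogonalProjection.
Variables (C : numClosedFieldType) (V : lmodType C) (form : V -> V -> C).
Hypothesis form_linear : forall v, linear (form^~ v : V -> C^o).
Hypothesis form_conj : forall u v, form v u = (form u v)^*.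
Hypothesis form_eq0 : forall u, form u u = 0 -> u = 0.

Lemma formDl u v w : form (u + v) w = form u w + form v w.
Proof. exact: linD (form_linear w) u v. Qed.

Lemma formBl u v w : form (u - v) w = form u w - form v w.
Proof. exact: linB (form_linear w) u v. Qed.

Lemma formZl a u w : form (a *: u) w = a * form u w.
Proof. exact: linZ (form_linear w) a u. Qed.

Lemma formDr u v w : form u (v + w) = form u v + form u w.
Proof. by rewrite !(form_conj _ u) formDl rmorphD. Qed.

Lemma formZr a u v : form u (a *: v) = a^* * form u v.
Proof. by rewrite !(form_conj _ u) formZl rmorphM. Qed.

Lemma form_sumr u I (r : seq I) (F : I -> V) :
  form u (\sum_(i <- r) F i) = \sum_(i <- r) form u (F i).
Proof.
by apply: (big_morph (form u) (formDr u)); rewrite -(scale0r 0) formZr conjC0 mul0r.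
Qed.

(** Induction on n: given e != 0 in D, pass to the orthogonal complement of e in D,
    which is spanned by the projections of all the s i but one. *)
Lemma orthogonal_projection n (s : 'I_n -> V) (D : set V) :
    D 0 -> (forall a u v, D u -> D v -> D (a *: u + v)) ->
    (forall d, D d -> exists c : 'I_n -> C, d = \sum_i c i *: s i) ->
  forall v, exists2 d, D d & forall e, D e -> form (v - d) e = 0.
Proof.
have form0r u : form u 0 = 0 by rewrite -(scale0r 0) formZr conjC0 mul0r.
elim: n => [|n IHn] in s D * => D0 DD Ds v.
  by exists 0 => // e /Ds[c ->]; rewrite big_ord0.
have [[e De /eqP e_neq0]|no_e] := pselect (exists2 e, D e & e <> 0); last first.
  exists 0 => // e De; suff -> : e = 0 by [].
  by apply: contrapT => e_neq0; apply: no_e; exists e.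
have ee : form e e != 0 by apply: contra_neq e_neq0 => /form_eq0.
pose P u := u - (form u e / form e e) *: e.
have P_lin : linear P.
  move=> a u w; rewrite /P formDl formZl mulrDl scalerDl opprD addrACA.
  by rewrite scalerBr scalerA mulrA.
have Pe : P e = 0 by rewrite /P mulfV // scale1r subrr.
have DP u : D u -> D (P u).
  by move=> Du; rewrite /P addrC -scaleNr; apply: DD.
have P_orth u : form (P u) e = 0 by rewrite formBl formZl mulfVK ?subrr.
have [c def_e] := Ds e De.
have [i0 ci0] : exists i0, c i0 != 0.
  apply/existsP; apply: contraNT e_neq0; rewrite negb_exists => /forallP c0.
  rewrite def_e big1 // => i _; have := c0 i.
  by rewrite negbK => /eqP ->; rewrite scale0r.
(* Applying [P] to the expansion of [e] and using [Pe] expresses this vector by the other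
   projections. *)
have P_i0 : P (s i0) =
    \sum_j (- (c (fintype.lift i0 j) / c i0)) *: P (s (fintype.lift i0 j)).
  apply: (scalerI ci0); have := Pe; rewrite {1}def_e (lin_sum P_lin) (bigD1_ord i0) //=.
  rewrite (linZ P_lin) => /eqP; rewrite addr_eq0 => /eqP ->.
  rewrite scaler_sumr -sumrN; apply: eq_bigr => j _.
  by rewrite (linZ P_lin) scalerA mulrN mulrCA mulfV // mulr1 scaleNr.
have [||d [Dd de]|d' [Dd' d'e] d'_orth] := IHn (fun j => P (s (fintype.lift i0 j)))
    [set d | D d /\ form d e = 0] _ _ _ (P v).
- by split=> //; rewrite -(scale0r 0) formZl mul0r.
- move=> a u w [Du ue] [Dw we]; split; first exact: DD.
  by rewrite formDl formZl ue we mulr0 addr0.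
- have [a def_d] := Ds d Dd.
  exists (fun j => a (fintype.lift i0 j) - a i0 * (c (fintype.lift i0 j) / c i0)).
  have -> : d = P d by rewrite /P de mul0r scale0r subr0.
  rewrite {1}def_d (lin_sum P_lin) (bigD1_ord i0) //= (linZ P_lin) P_i0 scaler_sumr.
  rewrite -big_split; apply: eq_bigr => j _ /=.
  by rewrite (linZ P_lin) scalerA -scalerDl mulrN addrC.
exists ((form v e / form e e) *: e + d'); first exact: DD.
have orth_e : form (v - ((form v e / form e e) *: e + d')) e = 0.
  by rewrite opprD addrA formBl d'e P_orth subr0.
move=> x Dx; have -> : x = (form x e / form e e) *: e + P x by rewrite /P addrC subrK.
rewrite formDr formZr orth_e mulr0 add0r opprD addrA; apply: d'_orth.
by split; [exact: DP | exact: P_orth].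
Qed.

End OrthogonalProjection.

(** * Conformal weights *)

Section Weights.
Variables (C : numFieldType) (V : voa C).
Implicit Types (u v w : V) (k l m n : int).

Lemma vprod_linl n v : linear (fun u : V => vprod u n v : V).
Proof. exact: vprod_linearl (voa_vertex V) n v. Qed.

Lemma vprod_linr n u : linear (vprod u n : V -> V).
Proof. exact: vprod_linearr (voa_vertex V) n u. Qed.

Lemma Lop_linear n : linear (Lop n : V -> V).
Proof. exact: vprod_linr. Qed.

Lemma weight_vectorD n a u v :
  weight_vector n u -> weight_vector n v -> weight_vector n (a *: u + v).
Proof. by rewrite /weight_vector Lop_linear => -> ->; rewrite scalerDr !scalerA mulrC. Qed.

Lemma weight_vector0 n : weight_vector n (0 : V).
Proof. by rewrite /weight_vector (lin0 (@Lop_linear 0)) scaler0. Qed.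

Lemma weight_vectorZ n a u : weight_vector n u -> weight_vector n (a *: u).
Proof. by move=> un; rewrite -[a *: u]addr0; apply/weight_vectorD/weight_vector0. Qed.

Lemma weight_vector_sum n I (r : seq I) (P : pred I) (F : I -> V) :
  (forall i, P i -> weight_vector n (F i)) -> weight_vector n (\sum_(i <- r | P i) F i).
Proof.
move=> Fn; apply: (big_ind (@weight_vector _ V n)) => //; first exact: weight_vector0.
by move=> u v un vn; rewrite -[u]scale1r; apply: weight_vectorD.
Qed.

Lemma weight_Lop n k v : weight_vector n v -> weight_vector (n - k) (Lop k v).
Proof.
rewrite /weight_vector => vn; have [c vir] := conf_virasoro (voa_conformal V).
have := vir 0 k v; have -> : (0 ^+ 3 - 0 : int) = 0 by [].
rewrite (add0r k) (sub0r k) mul0r mul0r scale0r if_same addr0.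
move/eqP; rewrite subr_eq => /eqP ->; rewrite vn (linZ (@Lop_linear k)) -scalerDl.
by rewrite addrC -intrD.
Qed.

Lemma binz0 i : binz C 0 i = (i == 0%N)%:R.
Proof.
case: i => [|i]; rewrite /binz ?big_ord0 ?fact0 ?divr1 //.
by rewrite big_ord_recl subrr mul0r mul0r.
Qed.

Lemma binz1 i : binz C 1 i = (i <= 1)%N%:R.
Proof.
case: i => [|[|i]]; rewrite /binz ?big_ord0 ?big_ord1 ?fact0 ?divr1 //.
by rewrite 2!big_ord_recl /= subrr mul0r mulr0 mul0r.
Qed.

(** The Borcherds identity with l = 0 and m = 1 is the commutator formula for omega_1 and u_n; its
    term (L(-1)u)_(n+1) equals -(n+1) u_n. *)
Lemma Lop0_vprod u n v :
  Lop 0 (vprod u n v) = vprod (Lop 0 u) n v + vprod u n (Lop 0 v)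
    - (n + 1)%:~R *: vprod u n v.
Proof.
have sum2 (F : nat -> V) : \sum_(i \in `I_2) F i = F 0%N + F 1%N.
  by rewrite -fsbig_ord !big_ord_recr big_ord0 /= add0r.
have := vprod_borcherds (voa_vertex V) vconf u v 0 1 n.
rewrite -(fsbig_widen `I_2) => [|//|i [_ /= /negP]]; last first.
  by rewrite -leqNgt => i2; rewrite binz1 leqNgt i2 scale0r.
rewrite sum2 !binz1 !scale1r.
rewrite -(fsbig_widen [set 0%N]) => [|//|i [_ /= /eqP/negbTE i0]]; last first.
  by rewrite binz0 i0 mulr0 scale0r.
rewrite fsbig_set1 binz0 mulr1 expr0z !scale1r.
move=> borcherds.
have comm : vprod (vprod vconf 0 u) (n + 1) v + vprod (vprod vconf 1 u) n v =
    vprod vconf 1 (vprod u n v) - vprod u n (vprod vconf 1 v).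
  apply: etrans (etrans _ borcherds) _.
    congr (vprod (vprod _ _ _) _ _ + vprod (vprod _ _ _) _ _); lia.
  by congr (vprod _ _ (vprod _ _ _) - vprod _ _ (vprod _ _ _)); lia.
have deriv := conf_deriv (voa_conformal V) u (n + 1) v.
rewrite addrK scaleNr in deriv; move/eqP: comm.
rewrite [X in X + _ == _]deriv eq_sym subr_eq => /eqP comm; apply: (etrans comm).
by rewrite -addrA addrC.
Qed.

Lemma weight_vprod a b n u v : weight_vector a u -> weight_vector b v ->
  weight_vector (a + b - n - 1) (vprod u n v).
Proof.
rewrite /weight_vector => ua vb; rewrite Lop0_vprod ua vb.
rewrite (linZ (@vprod_linl n v)) (linZ (@vprod_linr n u)) -scalerDl -scalerBl.
by rewrite -rmorphD -rmorphB opprD addrA.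
Qed.

Lemma weight_filter n v (s : seq (int * V)) :
    weight_vector n v -> (forall y, y \in s -> weight_vector y.1 y.2) ->
  v = \sum_(y <- s) y.2 -> v = \sum_(y <- s | y.1 == n) y.2.
Proof.
(* Apply the product of the operators L(0) - k over the other weights k in s. *)
pose T ks u : V := foldr (fun (k : int) w => Lop 0 w - k%:~R *: w) u ks.
have T_lin ks : linear (T ks).
  elim: ks => [|k ks IHks] a u w //=; rewrite IHks Lop_linear scalerDr opprD addrACA.
  by rewrite scalerBr (scalerA a) mulrC -scalerA.
have TE ks m u : weight_vector m u ->
    T ks u = (\prod_(k <- ks) (m - k)%:~R) *: u.
  move=> um; elim: ks => [|k ks IHks] /=; first by rewrite big_nil scale1r.
  rewrite IHks (linZ (@Lop_linear 0)) um big_cons intrB mulrBl scalerBl !scalerA.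
  by rewrite mulrC.
move=> vn sw v_sum; pose ks := [seq y.1 | y <- s & y.1 != n].
have p_neq0 : \prod_(k <- ks) (n - k)%:~R != 0 :> C.
  rewrite prodf_seq_neq0; apply/allP => k /mapP[y + ->].
  by rewrite mem_filter intr_eq0 subr_eq0 eq_sym => /andP[].
apply: (scalerI p_neq0); rewrite -(TE _ _ _ vn) {1}v_sum (lin_sum (T_lin _)).
rewrite scaler_sumr big_mkcond [RHS]big_mkcond; apply: eq_big_seq => y ys /=.
rewrite (TE _ _ _ (sw _ ys)); case: eqVneq => [->//|yn].
have y_ks : y.1 \in ks by apply: map_f; rewrite mem_filter yn.
by rewrite (big_rem _ y_ks) /= subrr mul0r scale0r.
Qed.

End Weights.

(** * Splitting of a weight space into highest weight vectors and descendants *)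

Section Descendants.
Variables (C : numClosedFieldType) (V : voa C).
Implicit Types (u v w h d : V) (k l m n : int).

(** A pair (k, u) stands for L(-k-1)u, so that all modes L(-1), L(-2), ... are covered. *)
Definition descendant : set V :=
  [set v | exists s : seq (nat * V), v = \sum_(y <- s) Lop (- y.1.+1%:Z) y.2].

(** This is the space D_n; the weights of the vectors in the list are recorded for the induction on
    the weight. *)
Definition graded_descendant n : set V :=
  [set v | exists2 s : seq (nat * V),
     forall y, y \in s -> weight_vector (n - y.1.+1%:Z) y.2 &
     v = \sum_(y <- s) Lop (- y.1.+1%:Z) y.2].

Lemma graded_descendantW n v : graded_descendant n v -> descendant v.
Proof. by case=> s _ ->; exists s. Qed.

Lemma graded_descendantD n a u v :
  graded_descendant n u -> graded_descendant n v -> graded_descendant n (a *: u + v).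
Proof.
case=> s sn -> [t tn ->]; exists ([seq (y.1, a *: y.2) | y <- s] ++ t).
  move=> y; rewrite mem_cat => /orP[/mapP[{}y ys ->]|/tn //].
  by apply/weight_vectorZ/sn.
rewrite big_cat big_map /= scaler_sumr; congr (_ + _); apply: eq_bigr => y _.
by rewrite (linZ (@Lop_linear _ _ _)).
Qed.

Lemma descendantD a u v : descendant u -> descendant v -> descendant (a *: u + v).
Proof.
case=> s -> [t ->]; exists ([seq (y.1, a *: y.2) | y <- s] ++ t).
rewrite big_cat big_map /= scaler_sumr; congr (_ + _); apply: eq_bigr => y _.
by rewrite (linZ (@Lop_linear _ _ _)).
Qed.

Lemma descendant0 : descendant 0.
Proof. by exists [::]; rewrite big_nil. Qed.

Lemma graded_descendant_weight n v : graded_descendant n v -> weight_vector n v.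
Proof.
case=> s sn ->; rewrite big_seq; apply: weight_vector_sum => y /sn/weight_Lop.
by move=> /(_ (- y.1.+1%:Z)); rewrite opprK subrK.
Qed.

Lemma highest_weightD a u v :
  highest_weight u -> highest_weight v -> highest_weight (a *: u + v).
Proof. by move=> hu hv n n1; rewrite Lop_linear hu // hv // scaler0 addr0. Qed.

Lemma highest_weight0 : highest_weight (0 : V).
Proof. by move=> n _; rewrite (lin0 (@Lop_linear _ _ _)). Qed.

Definition virasoro_form (form : V -> V -> C) : Prop :=
  [/\ forall v, linear (form^~ v : V -> C^o), forall u v, form v u = (form u v)^*,
      forall u, form u u = 0 -> u = 0 &
      forall n u v, form (Lop n u) v = form u (Lop (- n) v)].

Variable form : V -> V -> C.
Hypothesis formV : virasoro_form form.

(** By adjointness a highest weight vector is orthogonal to every L(-k)u with k >= 1, so [v] is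
    orthogonal to itself. *)
Lemma highest_descendant_eq0 v : highest_weight v -> descendant v -> v = 0.
Proof.
case: formV => f_lin f_conj f_eq0 f_adj v_high [s def_v].
apply: f_eq0; rewrite {2}def_v (form_sumr f_lin f_conj) big1 // => y _.
by rewrite -f_adj v_high // (lin0 (f_lin _)).
Qed.

Lemma highest_weight_mod_descendant u h h' :
    highest_weight h -> highest_weight h' ->
  descendant (u - h) -> descendant (u - h') -> h = h'.
Proof.
move=> hh hh' dh dh'; apply/eqP; rewrite -subr_eq0; apply/eqP/highest_descendant_eq0.
  by rewrite -[h - h']addrC -scaleN1r; apply: highest_weightD.
have -> : h - h' = -1 *: (u - h) + (u - h').
  by rewrite scaleN1r opprB addrA subrK.
exact: descendantD.
Qed.

(** Let h be [v] minus its projection to D_n. For k >= 1 the vector L(-k)L(k)h lies in D_n, so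
    (L(k)h, L(k)h) = (h, L(-k)L(k)h) = 0 and L(k)h = 0. *)
Lemma highest_weight_decomposition n v : weight_vector n v ->
  exists h d,
    [/\ v = h + d, highest_weight h, weight_vector n h & graded_descendant n d].
Proof.
case: formV => f_lin f_conj f_eq0 f_adj vn.
have [s s_span] := conf_finite (voa_conformal V) n.
have [|||d Dd orth] := orthogonal_projection f_lin f_conj f_eq0
    (s := fun i : 'I_(size s) => s`_i) (D := graded_descendant n) _ _ _ v.
- by exists [::]; rewrite ?big_nil.
- by move=> a u w; apply: graded_descendantD.
- by move=> d /graded_descendant_weight/s_span[c ->]; exists (fun i => c i).
have hn : weight_vector n (v - d).
  rewrite addrC -scaleN1r; apply: weight_vectorD => //.
  exact: graded_descendant_weight.
exists (v - d), d; split=> //; first by rewrite subrK.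
move=> k k1; apply: f_eq0; rewrite f_adj; apply: orth.
have kE : k = `|k|.-1.+1%:Z by lia.
exists [:: (`|k|.-1, Lop k (v - d))] => [y|]; last by rewrite big_seq1 /= -kE.
by rewrite inE => /eqP -> /=; rewrite -kE; apply: weight_Lop.
Qed.

End Descendants.

(** * Automorphisms and averaging over G *)

Lemma hom_Lop (C : numFieldType) (V W : vertex_data C) (g : V -> W) (n : int) (v : V) :
  vertex_hom g -> g (Lop n v) = Lop n (g v).
Proof. by case=> _ _ gconf gprod; rewrite /Lop gprod gconf. Qed.

Section Automorphisms.
Variables (C : numClosedFieldType) (V : voa C).
Implicit Types (u v w h d : V) (k l m n : int) (g : V -> V).

Lemma hom_highest_weight g v : vertex_hom g -> highest_weight v -> highest_weight (g v).
Proof.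
by move=> gh hv n n1; rewrite -hom_Lop // hv // (lin0 _) //; case: gh.
Qed.

Lemma hom_descendant g v : vertex_hom g -> descendant v -> descendant (g v).
Proof.
move=> gh [s ->]; exists [seq (y.1, g y.2) | y <- s].
have [g_lin _ _ _] := gh; rewrite (lin_sum g_lin) big_map; apply: eq_bigr => y _ /=.
exact: hom_Lop.
Qed.

Lemma fixed_closed (G : set (V -> V)) :
  G `<=` Defs.Aut -> closed_subspace (fixed_points G).
Proof.
move=> GAut; split=> [g /GAut[[]]//|a u v uG vG g Gg|u n v uG vG g Gg].
all: have [[g_lin _ _ g_prod] _] := GAut _ Gg.
  by rewrite g_lin uG // vG.
by rewrite g_prod uG // vG.
Qed.

(** The Reynolds operator of the finite group G. It commutes with each L(n) because automorphisms
    fix omega. *)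
Lemma averaging (gT : finGroupType) (K : {group gT}) (G : set (V -> V)) :
    G `<=` Defs.Aut -> isomorphic_to K G ->
  exists avg : V -> V,
    [/\ linear avg, forall v, fixed_points G (avg v),
        forall v, fixed_points G v -> avg v = v &
        forall n v, avg (Lop n v) = Lop n (avg v)].
Proof.
move=> GAut [F [FM _ FG]].
have F_hom x : x \in K -> vertex_hom (F x).
  by move=> xK; have [] // : Defs.Aut (F x) by apply: GAut; rewrite -FG; exists x.
have F_lin x : x \in K -> linear (F x) by move=> /F_hom[].
have K_neq0 : #|K|%:R != 0 :> C by rewrite pnatr_eq0 -lt0n cardG_gt0.
exists (fun v => #|K|%:R^-1 *: \sum_(x in K) F x v); split.
- move=> a u v; under eq_bigr => x xK do rewrite F_lin //.
  by rewrite big_split /= -scaler_sumr scalerDr !scalerA mulrC.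
- move=> v g Gg; move: (Gg); rewrite -FG => -[y yK <-].
  rewrite (linZ (F_lin y yK)) (lin_sum (F_lin y yK)); congr (_ *: _).
  rewrite [RHS](reindex_inj (mulgI y)) /=; apply: eq_big => x; first by rewrite groupMl.
  by move=> xK; rewrite FM.
- move=> v vG; rewrite (eq_bigr (fun=> v)) => [|x xK]; last first.
    by apply: vG; rewrite -FG; exists x.
  by rewrite sumr_const -scaler_nat scalerA mulVf ?scale1r.
- move=> n v; rewrite (linZ (@Lop_linear _ _ _)) (lin_sum (@Lop_linear _ _ _)).
  by congr (_ *: _); apply: eq_bigr => x xK; rewrite hom_Lop //; apply: F_hom.
Qed.

End Automorphisms.

(** * Products of highest weight vectors *)

Section Orbifold.
Variables (C : numClosedFieldType) (V : voa C) (form : V -> V -> C).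
Hypothesis formV : virasoro_form form.
(* The lattice vector e^(m alpha). *)
Variable e : nat -> V.
Hypothesis e_high : forall m, highest_weight (e m).
Hypothesis e_weight : forall m, weight_vector (m ^ 2)%N%:Z (e m).
Hypothesis e_neq0 : forall m, e m != 0.
Hypothesis e_prod : forall a b,
  vprod (e a) (- (2 * a * b)%N%:Z - 1) (e b) = e (a + b).
Variables (rho : 'M[C]_2 -> V -> V) (phi : V -> {mpoly C[2]}).
Hypothesis rhoP : PSL2_iso_Aut rho.
Hypothesis phiP : identification rho phi.
Implicit Types (u v w h d : V) (p q : {mpoly C[2]}) (A : 'M[C]_2).

Lemma rho_hom A : SL2 A -> vertex_hom (rho A).
Proof.
by case: rhoP => rho_Aut _ _ hA; have [] : Defs.Aut (rho A) by rewrite -rho_Aut; exists A.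
Qed.

Lemma phi_linear a u v : highest_weight u -> highest_weight v ->
  phi (a *: u + v) = a *: phi u + phi v.
Proof. by case: phiP => + _ _ _; apply. Qed.

Lemma phi_inj u v : highest_weight u -> highest_weight v -> phi u = phi v -> u = v.
Proof. by case: phiP => _ [_ inj _] _ _ hu hv; apply: inj; rewrite inE. Qed.

Lemma phi0 : phi 0 = 0.
Proof.
have h0 := highest_weight0 V; have := phi_linear (-1) h0 h0.
by rewrite scaler0 addr0 scaleN1r addNr.
Qed.

Lemma phi_rho A v : SL2 A -> highest_weight v -> phi (rho A v) = form_act A (phi v).
Proof. by case: phiP => _ _ + _; apply. Qed.

Lemma phi_homog m v : highest_weight v -> weight_vector (m ^ 2)%N%:Z v ->
  phi v \is (2 * m)%N.-homog.
Proof.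
case: phiP => _ _ _ /(_ m) img hv vm.
suff : [set p | p \is (2 * m)%N.-homog] (phi v) by [].
by rewrite -img; exists v.
Qed.

(** The inverse of [phi] on H, with value 0 off the image of H. *)
Definition psi p : V := xget 0 [set v | highest_weight v /\ phi v = p].

Lemma phiK v : highest_weight v -> psi (phi v) = v.
Proof.
rewrite /psi => hv; case: xgetP => [u _ [hu /phi_inj ->] //|/(_ v) []].
by split.
Qed.

Lemma psiP m p : p \is (2 * m)%N.-homog ->
  [/\ highest_weight (psi p), weight_vector (m ^ 2)%N%:Z (psi p) & phi (psi p) = p].
Proof.
case: phiP => _ _ _ /(_ m) img hp.
have : [set q | q \is (2 * m)%N.-homog] p by [].
rewrite -img => -[v [hv vm] <-].
by rewrite phiK //; split.
Qed.

Lemma psi_linear m a p q : p \is (2 * m)%N.-homog -> q \is (2 * m)%N.-homog ->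
  psi (a *: p + q) = a *: psi p + psi q.
Proof.
move=> /psiP[hp _ pp] /psiP[hq _ qq].
by rewrite -{1}pp -{1}qq -phi_linear // phiK //; apply: highest_weightD.
Qed.

Lemma psi_act m A p : SL2 A -> p \is (2 * m)%N.-homog ->
  psi (form_act A p) = rho A (psi p).
Proof.
move=> hA /psiP[hp _ pp]; rewrite -{1}pp -phi_rho // phiK //.
exact/hom_highest_weight/hp/rho_hom.
Qed.

(** The component in H modulo descendants, unique by [highest_weight_mod_descendant]; 0 is the
    default if there is none. *)
Definition highest_part u : V := xget 0 [set h | highest_weight h /\ descendant (u - h)].

Lemma highest_partE u h : highest_weight h -> descendant (u - h) -> highest_part u = h.
Proof.
rewrite /highest_part => hh dh; case: xgetP => [h' _ [hh' dh']|/(_ h) []]; last by split.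
exact: (highest_weight_mod_descendant formV hh' hh dh' dh).
Qed.

Lemma highest_partP n u : weight_vector n u ->
  [/\ highest_weight (highest_part u), weight_vector n (highest_part u) &
      graded_descendant n (u - highest_part u)].
Proof.
move=> /(highest_weight_decomposition formV)[h [d [-> hh hn Dd]]].
have dh : h + d - h = d by rewrite addrC addKr.
rewrite (highest_partE hh) ?dh //; exact: graded_descendantW Dd.
Qed.

(** The mode -2ab-1 is the one that sends weights a^2 and b^2 to (a+b)^2. *)
Definition highest_product (a b : nat) u v : V :=
  highest_part (vprod u (- (2 * a * b)%N%:Z - 1) v).

Lemma highest_product_weight (a b : nat) u v :
    weight_vector (a ^ 2)%N%:Z u -> weight_vector (b ^ 2)%N%:Z v ->
  weight_vector ((a + b) ^ 2)%N%:Z (vprod u (- (2 * a * b)%N%:Z - 1) v).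
Proof.
move=> ua vb; have := weight_vprod (- (2 * a * b)%N%:Z - 1) ua vb.
by congr weight_vector; lia.
Qed.

(** Each identity follows from the uniqueness of the highest part: the expected vector lies in H and
    differs from the product by a descendant. Automorphisms preserve both conditions. *)
Lemma highest_product_pairing (a b : nat) :
  equivariant_pairing (2 * a) (2 * b)
    (fun p q => phi (highest_product a b (psi p) (psi q))).
Proof.
have topW p q : p \is (2 * a)%N.-homog -> q \is (2 * b)%N.-homog ->
    [/\ highest_weight (highest_product a b (psi p) (psi q)),
        weight_vector ((a + b) ^ 2)%N%:Z (highest_product a b (psi p) (psi q)) &
        descendant (vprod (psi p) (- (2 * a * b)%N%:Z - 1) (psi q)
          - highest_product a b (psi p) (psi q))].
  move=> /psiP[_ pa _] /psiP[_ qb _].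
  by have [h1 h2 /graded_descendantW] := highest_partP (highest_product_weight pa qb).
have sub_lin (c : C) u v h h' : c *: u + v - (c *: h + h') = c *: (u - h) + (v - h').
  by rewrite scalerBr opprD addrACA.
split.
- move=> c p p' q hp hp' hq; rewrite (psi_linear c hp hp').
  have [h1 _ d1] := topW _ _ hp hq; have [h2 _ d2] := topW _ _ hp' hq.
  rewrite -phi_linear //; congr phi; apply: highest_partE; first exact: highest_weightD.
  by rewrite vprod_linl sub_lin; apply: descendantD.
- move=> c p q q' hp hq hq'; rewrite (psi_linear c hq hq').
  have [h1 _ d1] := topW _ _ hp hq; have [h2 _ d2] := topW _ _ hp hq'.
  rewrite -phi_linear //; congr phi; apply: highest_partE; first exact: highest_weightD.
  by rewrite vprod_linr sub_lin; apply: descendantD.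
- by move=> p q hp hq; have [h1 w1 _] := topW _ _ hp hq; rewrite -mulnDr phi_homog.
- move=> A p q hA hp hq; have [h1 _ d1] := topW _ _ hp hq; have hom := rho_hom hA.
  rewrite (psi_act hA hp) (psi_act hA hq) -phi_rho //; congr phi.
  apply: highest_partE; first exact: hom_highest_weight.
  have [r_lin _ _ r_prod] := hom; rewrite -r_prod -(linB r_lin).
  exact: hom_descendant.
Qed.

(** The constant is tested on [e a] and [e b]: their product [e (a + b)] is its own highest part and
    is nonzero. *)
Lemma psi_mul (a b : nat) : exists2 c : C, c != 0 &
  forall p q, p \is (2 * a)%N.-homog -> q \is (2 * b)%N.-homog ->
  graded_descendant ((a + b) ^ 2)%N%:Z
    (vprod (psi p) (- (2 * a * b)%N%:Z - 1) (psi q) - c *: psi (p * q)).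
Proof.
have [c cP] := equivariant_pairingP (highest_product_pairing a b).
have c_neq0 : c != 0.
  have := cP _ _ (phi_homog (e_high a) (e_weight a))
    (phi_homog (e_high b) (e_weight b)).
  rewrite !phiK // /highest_product e_prod (@highest_partE _ (e (a + b))) ?subrr //;
    last exact: descendant0.
  move=> phi_ab; apply: contraNneq (e_neq0 (a + b)) => c0; apply/eqP.
  apply: phi_inj => //; first exact: highest_weight0.
  by rewrite phi_ab c0 scale0r phi0.
exists c => // p q hp hq.
have [hp1 pa _] := psiP hp; have [hq1 qb _] := psiP hq.
have [h1 w1 d1] := highest_partP (highest_product_weight pa qb).
suff -> : c *: psi (p * q) =
    highest_part (vprod (psi p) (- (2 * a * b)%N%:Z - 1) (psi q)) by [].
have pq : p * q \is (2 * (a + b))%N.-homog by rewrite mulnDr dhomogM.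
have [hpq _ phi_pq] := psiP pq.
rewrite -[LHS]addr0; apply: phi_inj => //.
  exact/highest_weightD/highest_weight0.
by rewrite phi_linear ?phi_pq ?phi0 ?addr0 -?cP //; apply: highest_weight0.
Qed.

Variables (G : set (V -> V)) (avg : V -> V).
Hypothesis G_Aut : G `<=` Defs.Aut.
Hypothesis avg_linear : linear avg.
Hypothesis avg_fixed : forall v, fixed_points G (avg v).
Hypothesis avg_id : forall v, fixed_points G v -> avg v = v.
Hypothesis avg_Lop : forall n v, avg (Lop n v) = Lop n (avg v).
Variables (r : nat) (b : 'I_r -> nat) (f : r.-tuple {mpoly C[2]}) (vf : 'I_r -> V).
Hypothesis f_homog : forall i, tnth f i \is (2 * b i)%N.-homog.
Hypothesis f_gen :
  range (fun P : {mpoly C[r]} => P \mPo f) = form_invariants (preimage_SL2 rho G).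
Hypothesis vf_high : forall i, highest_weight (vf i) /\ phi (vf i) = tnth f i.

Lemma fixed_rho v :
  (forall A, preimage_SL2 rho G A -> rho A v = v) -> fixed_points G v.
Proof.
move=> rho_v g Gg; have := G_Aut Gg; case: rhoP => <- _ _ [A hA def_g].
by rewrite -def_g; apply: rho_v; split=> //; rewrite def_g.
Qed.

Lemma psi_fixed m p : p \is (2 * m)%N.-homog ->
  form_invariants (preimage_SL2 rho G) p -> fixed_points G (psi p).
Proof.
move=> hp p_inv; apply: fixed_rho => A GA; have [hA _] := GA.
by rewrite -(psi_act hA hp) p_inv.
Qed.

Lemma vf_fixed i : fixed_points G (vf i).
Proof.
have [hv fv] := vf_high i.
rewrite -[vf i]phiK // fv; apply: psi_fixed; first exact: f_homog.
rewrite -f_gen; exists 'X_i => //; by rewrite comp_mpolyXU -tnth_nth.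
Qed.

Variable W : set V.
Hypothesis W_closed : closed_subspace W.
Hypothesis W_conf : W vconf.
Hypothesis W_gen : forall i, W (vf i).

Lemma closed_lin a u v : W u -> W v -> W (a *: u + v).
Proof. by case: W_closed => _ + _; apply. Qed.

Lemma closed0 : W 0.
Proof.
by case: W_closed => Wvac _ _; have := closed_lin (-1) Wvac Wvac; rewrite scaleN1r addNr.
Qed.

Lemma closed_sum I (s : seq I) (P : pred I) (F : I -> V) :
  (forall i, P i -> W (F i)) -> W (\sum_(i <- s | P i) F i).
Proof.
move=> WF; apply: (big_ind W) => //; first exact: closed0.
by move=> u v Wu Wv; rewrite -[u]scale1r; apply: closed_lin.
Qed.

Lemma closed_vprod u n v : W u -> W v -> W (vprod u n v).
Proof. by case: W_closed => _ _; apply. Qed.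

Lemma avg_weight n v : weight_vector n v -> weight_vector n (avg v).
Proof.
by rewrite /weight_vector => vn; rewrite -avg_Lop vn (linZ avg_linear).
Qed.

(** Half the degree in x, y of a monomial in the basic invariants; its square is the weight of the
    corresponding vector. *)
Definition half_degree (m : 'X_{1..r}) : nat := \sum_i b i * m i.

Lemma monomial_homog m : 'X_[m] \mPo f \is (2 * half_degree m)%N.-homog.
Proof.
rewrite comp_mpolyX /half_degree big_distrr /=.
elim/big_ind2: _ => [|p k q l hp hq|i _]; [exact: dhomog1 | exact: dhomogM |].
by rewrite mulnA; apply: dhomogMn.
Qed.

Lemma monomial_fixed m : fixed_points G (psi ('X_[m] \mPo f)).
Proof.
apply: psi_fixed (monomial_homog m) _.
by rewrite -f_gen; exists 'X_[m].
Qed.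

(** Forms of degree 0 are constants, so the vacuum, which has weight 0 and lies in H, is a nonzero
    multiple of [psi 1]. *)
Lemma mem_psi1 : W (psi 1).
Proof.
have vac_high : highest_weight (vac : V).
  by move=> k k1; apply: (vprod_vacr0 (voa_vertex V)); lia.
have vac_weight : weight_vector (0 ^ 2)%N%:Z (vac : V).
  by rewrite /weight_vector scale0r; apply: (vprod_vacr0 (voa_vertex V)).
(* A zero vacuum would make its mode -1, the identity, vanish on the nonzero vector [e 0]. *)
have vac_neq0 : vac <> 0 :> V.
  move=> vac0; have := e_neq0 0%N; have := vprod_vacl (voa_vertex V) (-1) (e 0%N).
  by rewrite eqxx vac0 (lin0 (@vprod_linl _ _ _ _)) => <-; rewrite eqxx.
have [c phi_vac] : exists c, phi vac = c *: 1.
  have := phi_homog vac_high vac_weight; elim/homog_ind => [|a k p + _ [c ->]].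
    by exists 0; rewrite scale0r.
  by rewrite leqn0 => /eqP ->; exists (a + c); rewrite scalerDl /bimonom mulr1.
have hom1 : (1 : {mpoly C[2]}) \is (2 * 0)%N.-homog by rewrite muln0 dhomog1.
have [h1 _ phi_1] := psiP hom1.
have def_vac : vac = c *: psi 1.
  rewrite -[RHS]addr0; apply: phi_inj => //; first exact/highest_weightD/highest_weight0.
  by rewrite phi_linear ?phi_1 ?phi0 ?addr0 //; apply: highest_weight0.
have c_neq0 : c != 0 by apply/eqP => c0; apply: vac_neq0; rewrite def_vac c0 scale0r.
have -> : psi 1 = c^-1 *: vac + 0 by rewrite addr0 def_vac scalerA mulVf // scale1r.
by apply: (closed_lin _ _ closed0); case: W_closed.
Qed.

(** * Induction on the conformal weight *)

Section Induction.
Variable n : int.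
Hypothesis IHn : forall k v, k < n -> weight_vector k v -> fixed_points G v -> W v.

(** Averaging passes through L(-j), so the result is a sum of L(-j)w with w fixed by G and of weight
    below n; such w lie in [W], and so does omega. *)
Lemma mem_avg_descendant k d : k <= n -> graded_descendant k d -> W (avg d).
Proof.
move=> kn [s s_wt ->]; rewrite (lin_sum avg_linear) big_seq; apply: closed_sum.
move=> y /s_wt y_wt.
rewrite avg_Lop; apply: closed_vprod => //.
by apply: (IHn (k := k - y.1.+1%:Z)); [lia | apply: avg_weight | apply: avg_fixed].
Qed.

(** Induction on the degree of the monomial: split off one basic invariant and multiply by its
    vector; [psi_mul] gives the monomial up to a descendant. *)
Lemma mem_psi_monomial m : ((half_degree m) ^ 2)%N%:Z <= n -> W (psi ('X_[m] \mPo f)).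
Proof.
move: {2}(mdeg m) (erefl (mdeg m)) => k; elim: k m => [|k IHk] m mk mn.
  move/eqP: mk; rewrite mdeg_eq0 => /eqP ->; rewrite mpolyX0 comp_mpoly1; exact: mem_psi1.
have [i i_m] : exists i, (U_(i) <= m)%MM.
  have : m != 0%MM by rewrite -mdeg_eq0 mk.
  case: (pickP (fun i => m i != 0%N)) => [i m_i _|m0 /eqP[]].
    by exists i; rewrite lep1mP.
  by apply/mnmP => i; rewrite mnm0E; apply/eqP/negbFE/m0.
have def_m : m = (m - U_(i) + U_(i))%MM by rewrite submK.
set m' := (m - U_(i))%MM in def_m.
have wt_m : half_degree m = (half_degree m' + b i)%N.
  rewrite /half_degree [in LHS]def_m (bigD1 i) //= [in RHS](bigD1 i) //= mnmDE mnm1E eqxx.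
  rewrite addn1 mulnSr addnAC; congr (_ + _ + _)%N; apply: eq_bigr => j ji.
  by rewrite mnmDE mnm1E eq_sym (negbTE ji) addn0.
have m'k : mdeg m' = k by move: mk; rewrite def_m mdegD mdeg1 addn1 => -[].
have W_m' : W (psi ('X_[m'] \mPo f)).
  by apply: IHk => //; apply: le_trans mn; rewrite wt_m lez_nat leq_exp2r // leq_addr.
have [c c_neq0 cP] := psi_mul (half_degree m') (b i).
have [hvi phi_vi] := vf_high i.
have := cP _ _ (monomial_homog m') (f_homog i).
rewrite -{1}phi_vi phiK // -wt_m.
have -> : ('X_[m'] \mPo f) * tnth f i = 'X_[m] \mPo f.
  by rewrite def_m mpolyXD rmorphM /= comp_mpolyXU -tnth_nth.
set u := vprod _ _ _; set v := psi ('X_[m] \mPo f) => /(mem_avg_descendant mn).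
have Wu : W u by apply: closed_vprod.
have u_fix : fixed_points G u.
  move=> g Gg; have [[_ _ _ g_prod] _] := G_Aut Gg.
  by rewrite g_prod monomial_fixed // vf_fixed.
(* Both [u] and [v] are fixed by G, so averaging leaves the descendant u - cv unchanged; it lies in
   [W], and [v] is recovered since c is nonzero. *)
rewrite (linB avg_linear) avg_id // (linZ avg_linear) (avg_id (monomial_fixed m)) -/v => Wd.
have -> : v = c^-1 *: (-1 *: (u - c *: v) + u) + 0.
  by rewrite addr0 scaleN1r opprB subrK scalerA mulVf // scale1r.
by apply: (closed_lin _ _ closed0); apply: closed_lin.
Qed.

(** The form of [v] is a polynomial P in the basic invariants. P may contain monomials of other
    weights; [weight_filter] discards them, leaving those covered by [mem_psi_monomial]. *)
Lemma mem_highest_weight v :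
  highest_weight v -> weight_vector n v -> fixed_points G v -> W v.
Proof.
move=> hv vn v_fix.
have : form_invariants (preimage_SL2 rho G) (phi v).
  by move=> A [hA GA]; rewrite -phi_rho // v_fix.
rewrite -f_gen => -[P _ def_v].
have def_v' : v = \sum_(y <-
    [seq ((half_degree m ^ 2)%N%:Z, P@_m *: psi ('X_[m] \mPo f)) | m <- msupp P]) y.2.
  rewrite big_map /=.
  have [hs phi_s] : highest_weight (\sum_(m <- msupp P) P@_m *: psi ('X_[m] \mPo f)) /\
      phi (\sum_(m <- msupp P) P@_m *: psi ('X_[m] \mPo f)) =
      \sum_(m <- msupp P) P@_m *: ('X_[m] \mPo f).
    elim: (msupp P) => [|m s [hs phi_s]].
      by rewrite !big_nil phi0; split=> //; apply: highest_weight0.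
    have [hm _ phi_m] := psiP (monomial_homog m).
    by rewrite !big_cons; split; [exact: highest_weightD | rewrite phi_linear // phi_m phi_s].
  apply: phi_inj => //; rewrite phi_s -def_v {1}(mpolyE P) raddf_sum.
  by apply: eq_bigr => m _; rewrite /= comp_mpolyZ.
rewrite (weight_filter vn _ def_v') => [|y /mapP[m _ ->]]; last first.
  by apply: weight_vectorZ; have [] := psiP (monomial_homog m).
rewrite big_map; apply: closed_sum => m /= /eqP wt_m.
by rewrite -[_ *: _]addr0; apply/closed_lin/closed0/mem_psi_monomial; rewrite wt_m.
Qed.

Lemma mem_weight_fixed v : weight_vector n v -> fixed_points G v -> W v.
Proof.
move=> vn v_fix; rewrite -(avg_id v_fix).
have [h [d [-> hh hn Dd]]] := highest_weight_decomposition formV vn.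
rewrite (linD avg_linear) -[avg h]scale1r.
apply: closed_lin; last exact: mem_avg_descendant Dd.
apply: mem_highest_weight; [|exact: avg_weight|exact: avg_fixed].
by move=> k k1; rewrite -avg_Lop hh // (lin0 avg_linear).
Qed.

End Induction.

Lemma mem_fixed v : fixed_points G v -> W v.
Proof.
move=> v_fix; rewrite -(avg_id v_fix).
have [N0 N0P] := conf_bounded (voa_conformal V).
(* Since weights are bounded below by [N0], induction on the natural number [k] starts from zero
   weight spaces. *)
have WN k n u : n < N0 + k%:Z -> weight_vector n u -> fixed_points G u -> W u.
  elim: k n u => [|k IHk] n u.
    by rewrite addr0 => nN /(N0P _ _ nN) -> _; apply: closed0.
  by move=> nk; apply: mem_weight_fixed => l w ln; apply: IHk; lia.
have [s [-> s_wt]] := conf_graded (voa_conformal V) v.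
rewrite (lin_sum avg_linear) big_seq; apply: closed_sum => w /s_wt[n wn].
apply: (WN `|n - N0|.+1 n); [lia | exact: avg_weight | exact: avg_fixed].
Qed.

End Orbifold.

(** * Transfer from the Fock space to V, and the three groups *)

Lemma lattice_virasoro_form (C : numClosedFieldType) (V : voa C) (f : V -> VL2 C) :
  vertex_hom f -> injective f -> virasoro_form (fun u v : V => fock_form (f u) (f v)).
Proof.
move=> f_hom f_inj; have [f_lin _ _ _] := f_hom; split.
- by move=> v a u w; rewrite f_lin; apply: fock_form_linear.
- by move=> u v; apply: fock_form_conj.
- by move=> u /fock_form_eq0 fu; apply: f_inj; rewrite fu (lin0 f_lin).
- by move=> n u v; rewrite !(hom_Lop _ _ f_hom) Lop_adjoint.
Qed.

(** Common form of the three cases: a finite group and any finite family of homogeneous generators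
    of even degree for its invariants. *)
Lemma fixed_points_generated (C : numClosedFieldType) (V : voa C)
    (HV : vertex_isomorphic V (VL2 C))
    (rho : 'M[C]_2 -> V -> V) (Hrho : PSL2_iso_Aut rho)
    (phi : V -> {mpoly C[2]}) (Hphi : identification rho phi)
    (G : set (V -> V)) (HG : Aut_subgroup G)
    (gT : finGroupType) (K : {group gT}) (KG : isomorphic_to K G)
    (n : nat) (b : 'I_n -> nat) (f : n.-tuple {mpoly C[2]}) (v : 'I_n -> V)
    (f_homog : forall i, tnth f i \is (2 * b i)%N.-homog)
    (f_gen : range (fun P : {mpoly C[n]} => P \mPo f) =
             form_invariants (preimage_SL2 rho G))
    (v_high : forall i, highest_weight (v i) /\ phi (v i) = tnth f i) :
  generates (fixed_points G) (vconf |` range v).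
Proof.
have [G_Aut _ _ _] := HG.
have [avg [avg_lin avg_fix avg_id avg_Lop]] := averaging G_Aut KG.
have [F [F_hom [F' FK F'K]]] := HV; have [F_lin _ _ F_prod] := F_hom.
have F_inj : injective F := can_inj FK.
have formV := lattice_virasoro_form F_hom F_inj.
pose e (m : nat) := F' (fock_basis C (mset0, m%:Z)).
have e_high m : highest_weight (e m).
  move=> k k1; apply: F_inj; rewrite (hom_Lop _ _ F_hom) F'K (lin0 F_lin) Lop_exp.
    by rewrite ifN //; lia.
  by lia.
have e_weight m : weight_vector (m ^ 2)%N%:Z (e m).
  apply: F_inj; rewrite (hom_Lop _ _ F_hom) (linZ F_lin) F'K Lop_exp //.
have e_neq0 m : e m != 0.
  apply/eqP => /(congr1 F); rewrite F'K (lin0 F_lin) => /(congr1 (coeff (mset0, m%:Z))).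
  by rewrite coeffU eqxx mulr1 coeff0 => /eqP; rewrite oner_eq0.
have e_prod k l : vprod (e k) (- (2 * k * l)%N%:Z - 1) (e l) = e (k + l)%N.
  apply: F_inj; rewrite F_prod !F'K PoszD -fock_prod_exp.
  by rewrite !PoszM.
rewrite /generates; apply/seteqP; split=> [u gen_u|u u_fix W W_closed W_gen].
  apply: gen_u; first exact: fixed_closed.
  move=> w [->|[i _ <-]]; first by move=> g /G_Aut[[]].
  exact: (vf_fixed Hrho Hphi G_Aut f_homog f_gen v_high).
apply: (mem_fixed formV e_high e_weight e_neq0 e_prod Hrho Hphi G_Aut avg_lin avg_fix
  avg_id avg_Lop f_homog f_gen v_high W_closed) => // [|i].
  by apply: W_gen; left.
by apply: W_gen; right; exists i.
Qed.

Theorem proposition3p4 (R : realType) (V : voa R[i])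
    (HV : vertex_isomorphic V (VL2 R[i]))
    (rho : 'M[R[i]]_2 -> V -> V) (Hrho : PSL2_iso_Aut rho)
    (phi : V -> {mpoly R[i][2]}) (Hphi : identification rho phi)
    (G : set (V -> V)) (HG : Aut_subgroup G)
    (f1 f2 f3 : {mpoly R[i][2]})
    (HGf : let A := form_invariants (preimage_SL2 rho G) in
       [\/ isomorphic_to 'Alt_('I_4)%G G /\
             presented_by A [tuple 6; 8; 12]%N [tuple f1; f2; f3] (rel_Alt4 R[i]),
           isomorphic_to 'Sym_('I_4)%G G /\
             presented_by A [tuple 8; 12; 18]%N [tuple f1; f2; f3] (rel_Sym4 R[i])
         | isomorphic_to 'Alt_('I_5)%G G /\
             presented_by A [tuple 12; 20; 30]%N [tuple f1; f2; f3] (rel_Alt5 R[i])])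
    (v1 v2 v3 : V)
    (Hv1 : highest_weight v1 /\ phi v1 = f1)
    (Hv2 : highest_weight v2 /\ phi v2 = f2)
    (Hv3 : highest_weight v3 /\ phi v3 = f3) :
  generates (fixed_points G) [set vconf; v1; v2; v3].
Proof.
have -> : [set vconf; v1; v2; v3] = vconf |` range (tnth [tuple v1; v2; v3]).
  apply/seteqP; split=> [u [[[->|->]|->]|->]|u [->|[[[|[|[|//]]] h] _ <-]]].
  - by left.
  - by right; exists ord0.
  - by right; exists (inord 1); rewrite // (tnth_nth 0) inordK.
  - by right; exists (inord 2); rewrite // (tnth_nth 0) inordK.
  - by do 3!left.
  - by do 2!left; right.
  - by left; right.
  - by right.
have v_high (i : 'I_3) : highest_weight (tnth [tuple v1; v2; v3] i) /\
    phi (tnth [tuple v1; v2; v3] i) = tnth [tuple f1; f2; f3] i.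
  by case: i => -[|[|[|//]]] h; rewrite !(tnth_nth 0).
(* The degrees are written as doubles because a form of degree 2m corresponds to a vector of weight
   m^2. *)
have even_deg d (b : 3.-tuple nat) :
    (forall i, tnth [tuple f1; f2; f3] i \is (tnth d i).-homog) ->
    d = [tuple of map (muln 2) b] ->
  forall i, tnth [tuple f1; f2; f3] i \is (2 * tnth b i)%N.-homog.
  by move=> + def_d i => /(_ i); rewrite def_d tnth_map.
case: HGf => -[KG [f_hom gen _]].
- have f_deg := even_deg _ [tuple 3; 4; 6]%N f_hom.
  apply: (fixed_points_generated HV Hrho Hphi HG KG (f_deg _) gen v_high).
  exact: val_inj.
- have f_deg := even_deg _ [tuple 4; 6; 9]%N f_hom.
  apply: (fixed_points_generated HV Hrho Hphi HG KG (f_deg _) gen v_high).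
  exact: val_inj.
- have f_deg := even_deg _ [tuple 6; 10; 15]%N f_hom.
  apply: (fixed_points_generated HV Hrho Hphi HG KG (f_deg _) gen v_high).
  exact: val_inj.
Qed.
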